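(* Let $\mathcal{Q}=(M,\mathcal{G},\nabla,S,d)$ be a flat logarithmic quantum differential system on $M=\mathbb{C}$, the connection $\nabla$ having in the basis $\omega=(\omega_0,\dots,\omega_{\mu-1})$ the matrix $$\tau M_1(x)\frac{dx}{x}-(A_\infty+\tau A_0(x))\frac{d\tau}{\tau}.$$ Let $\mathcal{G}^{\nabla}=\ker\nabla$ and $\mathcal{G}^{cl,\nabla^{cl}}=\ker\nabla^{cl}$. Assume that the fundamental solution $P(\tau,x)=H(\tau,x)e^{-\tau M_1(0)\ln x}$, with $H(\tau,0)=I$, is canonical. Then we have isomorphisms $$\mathcal{G}^{\nabla}\longrightarrow\mathcal{G}^{cl,\nabla^{cl}}\longrightarrow\mathcal{G}^{const},\qquad\Psi(\tau,x)\mapsto\Psi^{cl}(\tau)\mapsto\Psi^{const},$$ where $\Psi(\tau,x)=H(\tau,x)e^{-\tau M_1(0)\ln x}\Psi^{cl}(\tau)$ and $\Psi^{cl}(\tau)=(-\tau)^{A_\infty}(-\tau)^{A_0(0)}\Psi^{const}$, $\Psi^{const}$ being a constant vector.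
   Context: Let $\theta$ be the coordinate on $\mathbb{P}^1$ centered at $0$, $\tau=\theta^{-1}$, $j(\theta,x)=(-\theta,x)$. A flat logarithmic quantum differential system on $M=\mathbb{C}$ (coordinate $x$) is a tuple $(M,\mathcal{G},\nabla,S,d)$, $d\in\mathbb{Z}$, where $\mathcal{G}$ is a holomorphic bundle on $\mathbb{P}^1\times M$ with a basis $\omega$ of global sections, $\nabla$ is a flat meromorphic connection on $\mathcal{G}$ whose matrix in $\omega$ has the displayed form ($M_1,A_0$ holomorphic on $\mathbb{C}$, $A_\infty$ constant and semi-simple), and $S:\mathcal{O}(\mathcal{G})\times j^*\mathcal{O}(\mathcal{G})\to\theta^d\mathcal{O}_{\mathbb{P}^1\times M}$ is a $\nabla$-flat non-degenerate bilinear form; $S(\omega_i,\omega_j)=g(\omega_i,\omega_j)\theta^d$ with constants $g(\omega_i,\omega_j)$. Convention: $\nabla(\omega v)=\omega(dv+\Omega v)$; after the base change of matrix $P$ the matrix is $P^{-1}\Omega P+P^{-1}dP$. Flat sections are multivalued in $x\neq0$, $\tau\neq0$ and are identified with their coordinate vectors in $\omega$ (resp. $[\![\omega]\!]$). The classical limit $\mathcal{G}^{cl}$ is the trivial bundle on $\mathbb{P}^1$ with basis $[\![\omega]\!]=([\![\omega_0]\!],\dots,[\![\omega_{\mu-1}]\!])$ (classes of the $\omega_i$ modulo $x$), equipped with the connection $\nabla^{cl}$ with matrix $-(A_\infty+\tau A_0(0))\frac{d\tau}{\tau}$ in $[\![\omega]\!]$; $\mathcal{G}^{const}$ is its fiber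 at $\tau=-1$, a vector space with basis $[\![\omega]\!]$. The Dubrovin connection is the part of $\nabla$ with matrix $\tau M_1(x)\frac{dx}{x}$. A fundamental solution is an invertible matrix $P=P_0(x)+\sum_{i\ge1}P_i(x)\tau^i$ (coefficients multivalued holomorphic in $x\neq0$) such that $\omega P$ is annihilated by the Dubrovin connection; there is a unique $H$ holomorphic on $(\mathbb{C},0)\times\mathbb{C}$, with $H=I$ at $x=0$, such that $H e^{-\tau M_1(0)\ln x}$ is a fundamental solution. A fundamental solution is symmetric if $\eta^{-1}P(-\tau,x)^T\eta P(\tau,x)=I$ ($\eta$ the Gram matrix of $g$ in $\omega$), conformal if after the base change of matrix $P$ the matrix of $\nabla$ is $(R_0+R_1\tau+\cdots+R_\delta\tau^\delta)\frac{d\tau}{\tau}$ with constant $R_k$, $[R_0,R_k]=-kR_k$ for $k\ge1$, and canonical if it is conformal, symmetric and $R_k=0$ for $k\ge2$.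
   Formalization: The second factor is (-τ)^{-A_0(0)} instead of (-τ)^{A_0(0)}: canonicity forces [A_∞,A_0(0)]=A_0(0), and with the stated sign of ∇^cl the printed product is not flat unless A_0(0)=0 (e.g. A_∞=diag(1,0), A_0=E_12, M_1=0). *)

(* Defs.v *)
From HB Require Import structures.
From mathcomp Require Import all_boot all_order all_algebra.
From mathcomp Require Import complex.
From mathcomp Require Import all_classical all_reals all_analysis.
Set Implicit Arguments.
Unset Strict Implicit.
Unset Printing Implicit Defensive.
Import Order.TTheory GRing.Theory Num.Theory.
Import numFieldNormedType.Exports.
Local Open Scope classical_set_scope.
Local Open Scope ring_scope.

(* MathComp-Analysis world. The notions of one-variable and two-variable      *)
(* holomorphy, the connections and the matrix exponential are defined over a  *)
(* numFieldType K, whose topology and norm are the canonical ones; they are   *)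
(* used with K = R[i], the complex numbers, R : realType, where [derivable]   *)
(* and [differentiable] mean complex differentiability.                       *)

Section MatrixFunctions.
Variable K : numFieldType.

Definition holomorphic1 m n (D : set K) (F : K -> 'M[K]_(m, n)) :=
  forall i j (z : K), D z -> derivable (fun w => F w i j) z 1.

Definition holomorphic2 m n (D : set (K * K)) (F : K * K -> 'M[K]_(m, n)) :=
  forall i j p, D p -> differentiable (fun q => F q i j) p.

Definition mxderive m n (F : K -> 'M[K]_(m, n)) (z : K) : 'M[K]_(m, n) :=
  \matrix_(i, j) derive1 (fun w => F w i j) z.

(* S is the sum of the series of matrices sum_k A_k, entry by entry.          *)
Definition mxseries_cvg m n (A : nat -> 'M[K]_(m, n)) (S : 'M[K]_(m, n)) :=
  forall i j, series (fun k => A k i j) @ \oo --> S i j.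

Definition mxexp n (A : 'M[K]_n) : 'M[K]_n :=
  \matrix_(i, j) limn (series (fun k => (k`!%:R)^-1 * (A ^+ k) i j)).

Definition commmx n (A B : 'M[K]_n) : 'M[K]_n := A *m B - B *m A.

(* P^-1 W P + P^-1 dP, for one coefficient W of the connection form and the   *)
(* corresponding logarithmic derivative dP of P.                              *)
Definition base_change n (P W dP : 'M[K]_n) : 'M[K]_n :=
  invmx P *m W *m P + invmx P *m dP.

End MatrixFunctions.

Section QuantumDifferentialSystem.
Variables (K : numFieldType) (mu : nat).

(* The connection of matrix                                                   *)
(*   tau M1(x) dx/x - (Ainf + tau A0(x)) dtau/tau.                            *)
Record logConnection := LogConnection {
  M1 : K -> 'M[K]_mu;
  A0 : K -> 'M[K]_mu;
  Ainf : 'M[K]_mu }.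

Implicit Type Q : logConnection.

(* Connection forms are given by their coefficients on the logarithmic forms  *)
(* dx/x and dtau/tau, dual to x d/dx and tau d/dtau.                          *)
Definition omega_x Q (tau x : K) : 'M[K]_mu := tau *: M1 Q x.
Definition omega_tau Q (tau x : K) : 'M[K]_mu := - (Ainf Q + tau *: A0 Q x).

(* Coefficient of d Omega + Omega /\ Omega on dx/x /\ dtau/tau.               *)
Definition flat_connection Q := forall tau x : K, tau != 0 -> x != 0 ->
  x *: mxderive (omega_tau Q tau) x
  - tau *: mxderive (fun t => omega_x Q t x) tau
  + commmx (omega_x Q tau x) (omega_tau Q tau x) = 0.

(* G tau x is the matrix of the S(omega_i, omega_j); the second argument of S *)
(* lives in the pull-back by j, whose connection form has coefficients        *)
(* omega_x (- tau) x and omega_tau (- tau) x because j fixes dtau/tau. These  *)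
(* are the equations dS(a, b) = S(nabla a, b) + S(a, nabla b) on the basis.   *)
Definition flat_form Q (G : K -> K -> 'M[K]_mu) :=
  forall tau x : K, tau != 0 -> x != 0 ->
  x *: mxderive (G tau) x =
    (omega_x Q tau x)^T *m G tau x + G tau x *m omega_x Q (- tau) x /\
  tau *: mxderive (fun t => G t x) tau =
    (omega_tau Q tau x)^T *m G tau x + G tau x *m omega_tau Q (- tau) x.

(* gram is the Gram matrix eta of g; theta ^ d = tau ^ (- d), d = weight.      *)
Record logQDS := LogQDS {
  qds_connection :> logConnection;
  gram : 'M[K]_mu;
  weight : int;
  M1_holomorphic : holomorphic1 setT (M1 qds_connection);
  A0_holomorphic : holomorphic1 setT (A0 qds_connection);
  Ainf_semisimple : diagonalizable (Ainf qds_connection);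
  nabla_flat : flat_connection qds_connection;
  form_nondegenerate : gram \in unitmx;
  form_flat :
    flat_form qds_connection (fun tau _ => tau ^ (- weight) *: gram) }.

End QuantumDifferentialSystem.

Section MultivaluedSolutions.
Variables (R : realType) (mu : nat).
Notation C := R[i].
Implicit Types (Q : logConnection C mu) (r : \bar R).

Definition cexp (z : C) : C :=
  ((expR (complex.Re z) * cos (complex.Im z)) +i*
   (expR (complex.Re z) * sin (complex.Im z)))%C.

(* The radius r ranges over ]0, +oo]; disc +oo is C, so that r = +oo is the   *)
(* global situation and finite r represents the germ (C, 0). The norm of R[i] *)
(* is R[i]-valued (with zero imaginary part), hence the real part.            *)
Definition disc r : set C := [set x | ((complex.Re `|x|)%:E < r)%E].

(* Universal cover of the punctured disc: L stands for ln x, x = cexp L.      *)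
Definition logdisc r : set C := [set L | disc r (cexp L)].

(* Matrices P tau L depend on tau in C and on L = ln x.                       *)
Definition fundamental_solution Q r (P : C -> C -> 'M[C]_mu) :=
  [/\ exists2 Pc : nat -> C -> 'M[C]_mu,
        forall k, holomorphic1 (logdisc r) (Pc k) &
        forall tau L, logdisc r L ->
          mxseries_cvg (fun k => tau ^+ k *: Pc k L) (P tau L),
      holomorphic2 [set p | logdisc r p.2] (fun p => P p.1 p.2),
      (forall tau L, logdisc r L -> P tau L \in unitmx) &
      (forall tau L, logdisc r L ->
         mxderive (P tau) L + omega_x Q tau (cexp L) *m P tau L = 0)].

Definition symmetric_solution (e : 'M[C]_mu) r (P : C -> C -> 'M[C]_mu) :=
  forall tau L, logdisc r L ->
    invmx e *m (P (- tau) L)^T *m e *m P tau L = 1%:M.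

Definition conformal_with Q r (P : C -> C -> 'M[C]_mu)
    (delta : nat) (Rk : nat -> 'M[C]_mu) :=
  (forall k, (1 <= k <= delta)%N -> commmx (Rk 0%N) (Rk k) = - (k%:R *: Rk k))
  /\ forall tau L, tau != 0 -> logdisc r L ->
     base_change (P tau L) (omega_x Q tau (cexp L)) (mxderive (P tau) L) = 0 /\
     base_change (P tau L) (omega_tau Q tau (cexp L))
       (tau *: mxderive (fun t => P t L) tau) =
     \sum_(k < delta.+1) tau ^+ k *: Rk k.

Definition canonical_solution Q (e : 'M[C]_mu) r (P : C -> C -> 'M[C]_mu) :=
  symmetric_solution e r P /\
  exists delta Rk, conformal_with Q r P delta Rk /\
    (forall k, (2 <= k <= delta)%N -> Rk k = 0).

(* A multivalued section in tau != 0 and x != 0 is a function of (s, L) with  *)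
(* s = ln (- tau) and L = ln x; ds = dtau/tau and dL = dx/x. Sections over    *)
(* logdisc r are extended by zero, so that equal sections are equal functions.*)
Definition flat_section Q r (Psi : C * C -> 'cV[C]_mu) :=
  [/\ (forall s L, ~ logdisc r L -> Psi (s, L) = 0),
      holomorphic2 [set p | logdisc r p.2] Psi,
      (forall s L, logdisc r L ->
         mxderive (fun l => Psi (s, l)) L
         + omega_x Q (- cexp s) (cexp L) *m Psi (s, L) = 0) &
      (forall s L, logdisc r L ->
         mxderive (fun t => Psi (t, L)) s
         + omega_tau Q (- cexp s) (cexp L) *m Psi (s, L) = 0)].

(* The dtau/tau coefficient of nabla^cl is omega_tau at x = 0.                *)
Definition flat_section_cl Q (Psi : C -> 'cV[C]_mu) :=
  holomorphic1 setT Psi /\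
  forall s, mxderive Psi s + omega_tau Q (- cexp s) 0 *m Psi s = 0.

End MultivaluedSolutions.

Section LinearityOfHolomorphy.
Variable K : numFieldType.

Lemma derivable_slice1 (f : K * K -> K) (s L : K) :
  differentiable f (s, L) -> derivable (fun l => f (s, l)) L 1.
Proof.
move=> df; apply: diff_derivable.
exact: (@differentiable_comp _ _ _ _ (fun l : K => (s, l)) f).
Qed.

Lemma derivable_slice2 (f : K * K -> K) (s L : K) :
  differentiable f (s, L) -> derivable (fun t => f (t, L)) s 1.
Proof.
move=> df; apply: diff_derivable.
exact: (@differentiable_comp _ _ _ _ (fun t : K => (t, L)) f).
Qed.

Lemma derive1_lin (f g : K -> K) (a z : K) :
  derivable f z 1 -> derivable g z 1 ->
  derive1 (fun w => a * f w + g w) z = a * derive1 f z + derive1 g z.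
Proof.
move=> df dg; rewrite !derive1E.
have := @deriveD _ _ _ (a \*: f) g z 1 (@derivableZ _ _ _ f a z 1 df) dg.
by rewrite deriveZ.
Qed.

Lemma lin_entryE (T : Type) m n (F G : T -> 'M[K]_(m, n)) (a : K) i j :
  (fun w => (a *: F w + G w) i j) = (fun w => a * F w i j + G w i j).
Proof. by apply: funext => w; rewrite !mxE. Qed.

Lemma holomorphic1_lin m n D (F G : K -> 'M[K]_(m, n)) (a : K) :
  holomorphic1 D F -> holomorphic1 D G ->
  holomorphic1 D (fun w => a *: F w + G w).
Proof.
move=> dF dG i j z Dz; rewrite lin_entryE.
have dZ := @derivableZ _ _ _ _ a z 1 (dF i j z Dz).
exact: (@derivableD _ _ _ _ _ z 1 dZ (dG i j z Dz)).
Qed.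

Lemma holomorphic2_lin m n D (F G : K * K -> 'M[K]_(m, n)) (a : K) :
  holomorphic2 D F -> holomorphic2 D G ->
  holomorphic2 D (fun w => a *: F w + G w).
Proof.
move=> dF dG i j p Dp; rewrite lin_entryE.
have dZ := @differentiableZ _ _ _ _ a p (dF i j p Dp).
exact: (@differentiableD _ _ _ _ _ p dZ (dG i j p Dp)).
Qed.

Lemma holomorphic1_0 m n D : holomorphic1 D (fun=> 0 : 'M[K]_(m, n)).
Proof.
move=> i j z _; have -> : (fun _ : K => (0 : 'M[K]_(m, n)) i j) = cst 0.
  by apply: funext => w; rewrite mxE.
exact: derivable_cst.
Qed.

Lemma holomorphic2_0 m n D : holomorphic2 D (fun=> 0 : 'M[K]_(m, n)).
Proof.
move=> i j z _; have -> : (fun _ : K * K => (0 : 'M[K]_(m, n)) i j) = cst 0.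
  by apply: funext => w; rewrite mxE.
exact: differentiable_cst.
Qed.

Lemma mxderive_lin m n (F G : K -> 'M[K]_(m, n)) (a z : K) :
  (forall i j, derivable (fun w => F w i j) z 1) ->
  (forall i j, derivable (fun w => G w i j) z 1) ->
  mxderive (fun w => a *: F w + G w) z = a *: mxderive F z + mxderive G z.
Proof.
move=> dF dG; apply/matrixP => i j.
by rewrite !mxE lin_entryE (derive1_lin a (dF i j) (dG i j)).
Qed.

Lemma mxderive0 m n (z : K) : mxderive (fun=> 0 : 'M[K]_(m, n)) z = 0.
Proof.
apply/matrixP => i j; rewrite [LHS]mxE [RHS]mxE.
have -> : (fun _ : K => (0 : 'M[K]_(m, n)) i j) = cst 0.
  by apply: funext => w; rewrite mxE.
exact: derive1_cst.
Qed.

Lemma zero_eqn m n (A : 'M[K]_m) (z : K) :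
  mxderive (fun=> 0 : 'M[K]_(m, n)) z + A *m 0 = 0.
Proof. by rewrite mxderive0 mulmx0 addr0. Qed.

Lemma lin_eqn m n (A : 'M[K]_m) (F G : K -> 'M[K]_(m, n)) (a z : K) :
  (forall i j, derivable (fun w => F w i j) z 1) ->
  (forall i j, derivable (fun w => G w i j) z 1) ->
  mxderive F z + A *m F z = 0 -> mxderive G z + A *m G z = 0 ->
  mxderive (fun w => a *: F w + G w) z + A *m (a *: F z + G z) = 0.
Proof.
move=> dF dG eF eG; rewrite mxderive_lin // mulmxDr -scalemxAr addrACA.
by rewrite -scalerDr eF eG scaler0 addr0.
Qed.

Lemma holomorphic2_slice1 m n D (F : K * K -> 'M[K]_(m, n)) (s L : K) :
  holomorphic2 D F -> D (s, L) ->
  forall i j, derivable (fun l => F (s, l) i j) L 1.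
Proof.
move=> dF DsL i j; apply: (@derivable_slice1 (fun q => F q i j)).
exact: dF.
Qed.

Lemma holomorphic2_slice2 m n D (F : K * K -> 'M[K]_(m, n)) (s L : K) :
  holomorphic2 D F -> D (s, L) ->
  forall i j, derivable (fun t => F (t, L) i j) s 1.
Proof.
move=> dF DsL i j; apply: (@derivable_slice2 (fun q => F q i j)).
exact: dF.
Qed.

Lemma lin_zero m n (a : K) (u v : 'M[K]_(m, n)) :
  u = 0 -> v = 0 -> a *: u + v = 0.
Proof. by move=> -> ->; rewrite scaler0 addr0. Qed.

End LinearityOfHolomorphy.

Section FlatSections.
Variables (R : realType) (mu : nat).
Notation C := R[i].
Implicit Types (Q : logConnection C mu) (r : \bar R).

Definition flat_sections Q r : {pred (C * C -> 'cV[C]_mu)} :=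
  fun Psi => `[< flat_section Q r Psi >].

Definition flat_sections_cl Q : {pred (C -> 'cV[C]_mu)} :=
  fun Psi => `[< flat_section_cl Q Psi >].

Lemma flat_sections_closed Q r : submod_closed (flat_sections Q r).
Proof.
split=> [|a u v /asboolP[u0 du uL us] /asboolP[v0 dv vL vs]]; apply/asboolP.
  split; [by []|exact: holomorphic2_0| |] => s L _; exact: zero_eqn.
split=> [s L rL||s L rL|s L rL].
- exact: (lin_zero a (u0 s L rL) (v0 s L rL)).
- exact: (@holomorphic2_lin _ _ _ _ u v a du dv).
- apply: (@lin_eqn _ _ _ _ (fun l => u (s, l)) (fun l => v (s, l))).
  + exact: (holomorphic2_slice1 du).
  + exact: (holomorphic2_slice1 dv).
  + exact: uL.
  + exact: vL.
- apply: (@lin_eqn _ _ _ _ (fun t => u (t, L)) (fun t => v (t, L))).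
  + exact: (holomorphic2_slice2 du).
  + exact: (holomorphic2_slice2 dv).
  + exact: us.
  + exact: vs.
Qed.

Lemma flat_sections_cl_closed Q : submod_closed (flat_sections_cl Q).
Proof.
split=> [|a u v /asboolP[du us] /asboolP[dv vs]]; apply/asboolP.
  split=> [|s]; [exact: holomorphic1_0|exact: zero_eqn].
split=> [|s]; first exact: (@holomorphic1_lin _ _ _ _ u v a du dv).
apply: (@lin_eqn _ _ _ _ u v) => [i j|i j||].
- exact: du.
- exact: dv.
- exact: us.
- exact: vs.
Qed.

HB.instance Definition _ Q r :=
  GRing.isSubmodClosed.Build C (C * C -> 'cV[C]_mu) (flat_sections Q r)
    (flat_sections_closed Q r).
HB.instance Definition _ Q :=
  GRing.isSubmodClosed.Build C (C -> 'cV[C]_mu) (flat_sections_cl Q)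
    (flat_sections_cl_closed Q).

(* The vector spaces ker nabla and ker nabla^cl.                              *)
Record ker_nabla Q r := KerNabla {
  ker_nabla_val :> C * C -> 'cV[C]_mu;
  _ : ker_nabla_val \in flat_sections Q r }.
HB.instance Definition _ Q r := [isSub for @ker_nabla_val Q r].
HB.instance Definition _ Q r := [Choice of ker_nabla Q r by <:].
HB.instance Definition _ Q r :=
  [SubChoice_isSubLmodule of ker_nabla Q r by <:].

Record ker_nabla_cl Q := KerNablaCl {
  ker_nabla_cl_val :> C -> 'cV[C]_mu;
  _ : ker_nabla_cl_val \in flat_sections_cl Q }.
HB.instance Definition _ Q := [isSub for @ker_nabla_cl_val Q].
HB.instance Definition _ Q := [Choice of ker_nabla_cl Q by <:].
HB.instance Definition _ Q := [SubChoice_isSubLmodule of ker_nabla_cl Q by <:].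

End FlatSections.

(* Main.v *)
Require Import Defs.
From HB Require Import structures.
From mathcomp Require Import all_boot all_order all_algebra.
From mathcomp Require Import complex ring lra.
From mathcomp Require Import all_classical all_reals all_analysis.
Set Implicit Arguments.
Unset Strict Implicit.
Unset Printing Implicit Defensive.
Import Order.TTheory GRing.Theory Num.Theory.
Import numFieldNormedType.Exports.
Local Open Scope classical_set_scope.
Local Open Scope ring_scope.

(* After the base change by P the matrix of nabla in the direction of tau is a
   matrix S0 + tau S1, and the whole point is that S0 = - Ainf and
   S1 = - A0(0), i.e. that the new connection is nabla^cl. Comparing the
   coefficients of tau^0 and tau^1 in Omega P + tau dP/dtau = P (S0 + tau S1)
   gives two equations between P(0, L) and dP/dtau(0, L), L = ln x. As L goes to
   - oo, P(0, L) tends to I and dP/dtau(0, L) + L M1(0) tends to 0, whence the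
   two identities. They also give [Ainf, A0(0)] = A0(0), so that
   s |-> e^{s Ainf} e^{- s A0(0)} is a fundamental solution of nabla^cl.
   Since the pairing provides a holomorphic inverse of P, namely
   eta^-1 P(- tau, L)^T eta, the map Psi |-> P^-1 Psi sends flat sections to
   flat sections of nabla^cl, and it is inverted by V |-> P V.                *)

(** * Functions of a complex variable *)

(** Two obstacles shape the analysis. The equation in tau holds only for tau <> 0, so its
    coefficients at tau = 0 are reached through limits of derivatives, for functions known to be
    differentiable but not assumed to be continuously so. And the relation in degree 1 contains L
    M1(0), which is unbounded as L goes to - oo: the remainder of dP/dtau must tend to 0, and not
    merely be small against L. Joint differentiability of H at (0, 0), with H(tau, 0) = I, bounds H
    - I but not its tau-derivative near x = 0. That derivative is recovered from values on the
    circle |tau| = 1/|L|, which shrinks as x = e^L tends to 0; since P(., L) and the exponential are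
    entire power series in tau, averaging over roots of unity replaces the contour integral.
    Dividing by L then shows that the unbounded terms cancel, which means [Ainf, M1(0)] = M1(0). The
    minus sign in e^{- s A0(0)} comes from moving A0(0) across e^{s Ainf}, which multiplies it by
    e^s = - tau. *)

Section ComplexModulus.
Variable R : realType.
Notation C := (Num.NumField.sort (R[i] : numFieldType)).
Implicit Types (z w l : C) (e : R).

(* The norm of R[i] takes its values in R[i]; cabs is the same number in R.   *)
Definition cabs z : R := complex.Re `|z|.

Lemma cabsE z : `|z| = (cabs z)%:C%C.
Proof. by rewrite /cabs normc_def. Qed.

Lemma cabs_ge0 z : 0 <= cabs z.
Proof. by rewrite -lecR -cabsE normr_ge0. Qed.

Lemma cabs0 : cabs 0 = 0 :> R. Proof. by rewrite /cabs normr0. Qed.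
Lemma cabs1 : cabs 1 = 1 :> R. Proof. by rewrite /cabs normr1. Qed.

Lemma cabs0_eq0 z : cabs z = 0 -> z = 0.
Proof. by move=> z0; apply/eqP; rewrite -normr_eq0 cabsE z0. Qed.

Lemma cabs_gt0 z : (0 < cabs z) = (z != 0).
Proof. by rewrite -ltcR -cabsE normr_gt0. Qed.

Lemma cabsM z w : cabs (z * w) = cabs z * cabs w.
Proof. by rewrite {1}/cabs normrM !cabsE -rmorphM. Qed.

Lemma cabsV z : cabs z^-1 = (cabs z)^-1.
Proof.
by apply: complexI; rewrite -cabsE normfV cabsE fmorphV.
Qed.

Lemma cabsX z n : cabs (z ^+ n) = cabs z ^+ n.
Proof. by elim: n => [|n IH]; rewrite ?expr0 ?cabs1 // !exprS cabsM IH. Qed.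

Lemma cabsN z : cabs (- z) = cabs z.
Proof. by rewrite /cabs normrN. Qed.

Lemma cabsBC z w : cabs (z - w) = cabs (w - z).
Proof. by rewrite -cabsN opprB. Qed.

Lemma cabsD z w : cabs (z + w) <= cabs z + cabs w.
Proof. by rewrite -lecR rmorphD /= -!cabsE ler_normD. Qed.

Lemma cabsB z w : cabs (z - w) <= cabs z + cabs w.
Proof. by rewrite -(cabsN w) cabsD. Qed.

Lemma cabsDB z w v : cabs (z - w) <= cabs (z - v) + cabs (v - w).
Proof. by apply: le_trans (cabsD _ _); rewrite addrA subrK. Qed.

Lemma cabs_sum (I : Type) (r : seq I) (P : pred I) (F : I -> C) :
  cabs (\sum_(i <- r | P i) F i) <= \sum_(i <- r | P i) cabs (F i).
Proof.
elim/big_rec2 : _ => [|i x y _ h]; first by rewrite cabs0.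
by apply: le_trans (cabsD _ _) _; rewrite lerD2l.
Qed.

Lemma cabs_real (x : R) : cabs x%:C%C = `|x|.
Proof. by rewrite /cabs normc_def /= expr0n /= addr0 sqrtr_sqr. Qed.

Lemma cabs_nat n : cabs n%:R = n%:R :> R.
Proof. by rewrite -(rmorph_nat (real_complex R)) cabs_real normr_nat. Qed.

Lemma normRe_le_cabs z : `|complex.Re z| <= cabs z.
Proof. by rewrite -lecR -cabsE; exact: normc_ge_Re. Qed.

Lemma cabs_i : cabs 'i%C = 1 :> R.
Proof. by rewrite /cabs normc_def /= expr0n expr1n add0r sqrtr1. Qed.

Lemma normIm_le_cabs z : `|complex.Im z| <= cabs z.
Proof.
by have := normRe_le_cabs (z * 'i%C); rewrite ReiNIm normrN cabsM cabs_i mulr1.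
Qed.

Lemma cabs_le_ReIm z : cabs z <= `|complex.Re z| + `|complex.Im z|.
Proof.
rewrite {1}(complexE z); apply: le_trans (cabsD _ _) _.
by rewrite cabsM !cabs_real cabs_i mul1r.
Qed.

Lemma cabs_small_eq0 z : (forall e, 0 < e -> cabs z <= e) -> z = 0.
Proof.
move=> h; apply: cabs0_eq0; apply/eqP; rewrite eq_le cabs_ge0 andbT.
by apply/ler_addgt0Pl => e e0; rewrite addr0 h.
Qed.

(** A positive element of [R[i]] is real, so the epsilons of the complex-valued norm may be taken in
    [R]. *)
Lemma cvgCP (T : Type) (F : set_system T) (FF : Filter F) (f : T -> C) l :
  f @ F --> l <-> forall e, 0 < e -> \forall t \near F, cabs (l - f t) < e.
Proof.
rewrite cvgrPdist_lt; split=> h e e0.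
  have /h : 0 < e%:C%C by rewrite ltcR.
  by apply: filterS => t; rewrite cabsE ltcR.
have eE : e = (complex.Re e)%:C%C by rewrite RRe_real // gtr0_real.
have e0' : 0 < complex.Re e by rewrite -ltcR -eE.
by apply: filterS (h _ e0') => t; rewrite eE cabsE ltcR.
Qed.

Lemma near0CP (P : C -> Prop) :
  (\forall h \near 0, P h) <-> exists2 d : R, 0 < d & forall h, cabs h < d -> P h.
Proof.
split=> [/nbhs_ballP[e /= e0 h]|[d d0 h]].
  have eE : e = (complex.Re e)%:C%C by rewrite RRe_real // gtr0_real.
  exists (complex.Re e); first by rewrite -ltcR -eE.
  move=> z ze; apply: h; rewrite -ball_normE /= sub0r normrN eE cabsE ltcR //.
apply/nbhs_ballP; exists d%:C%C => /=; first by rewrite ltcR.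
by move=> z; rewrite -ball_normE /= sub0r normrN cabsE ltcR; apply: h.
Qed.

(** The multiplied-out form of the difference quotient has no division, holds at h = 0 as well, and
    is the one in which all later estimates are made. *)
Lemma is_deriveCP (f : C -> C) z l : is_derive z 1 f l <->
  forall e, 0 < e -> exists2 d : R, 0 < d & forall h, cabs h < d ->
    cabs (f (z + h) - f z - h * l) <= e * cabs h.
Proof.
have eqh (h : C) : h != 0 -> l - h^-1 *: (f (h *: 1 + z) - f z) =
    - (h^-1 * (f (z + h) - f z - h * l)).
  move=> h0; rewrite /GRing.scale /= mulr1 (addrC h z).
  by field.
split=> [[df dl] e e0|h].
  have /cvgCP : (fun h => h^-1 *: ((f \o shift z) (h *: 1) - f z)) @ 0^' --> l.
    by rewrite -dl; exact: df.
  move=> /(_ _ e0); rewrite near_withinE => /near0CP[d d0 hd].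
  exists d => // h /hd hh; have [->|h0] := eqVneq h 0.
    by rewrite addr0 subrr mul0r subr0 cabs0 mulr0.
  have := hh h0; rewrite /= eqh // cabsN cabsM cabsV mulrC.
  by rewrite ltr_pdivrMr ?cabs_gt0 // => /ltW.
have cl : (fun h => h^-1 *: ((f \o shift z) (h *: 1) - f z)) @ 0^' --> l.
  apply/cvgCP => e e0; rewrite near_withinE; apply/near0CP.
  (* Halving e turns the non-strict bound into the strict one of the limit. *)
  have [|d d0 hd] := h (e / 2); first by rewrite divr_gt0.
  exists d => // k kd k0; rewrite /= eqh // cabsN cabsM cabsV mulrC.
  rewrite ltr_pdivrMr ?cabs_gt0 //; apply: le_lt_trans (hd _ kd) _.
  by rewrite ltr_pM2r ?cabs_gt0 // gtr_pMr // invf_lt1 // ltr1n.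
by apply: DeriveDef; [apply/cvg_ex; exists l | exact: cvg_lim cl].
Qed.

End ComplexModulus.

Section ComplexCalculus.
Variable R : realType.
Notation C := (Num.NumField.sort (R[i] : numFieldType)).
Implicit Types (f g : C -> C) (a b z w l : C) (e M : R).

Lemma is_deriveR_of_remainder (u : R -> R) (t m : R) :
  (forall e, 0 < e -> exists2 d : R, 0 < d & forall h : R, `|h| < d ->
    `|u (t + h) - u t - h * m| <= e * `|h|) -> is_derive t 1 u m.
Proof.
move=> hu.
have cl : (fun h => h^-1 *: ((u \o shift t) (h *: 1) - u t)) @ 0^' --> m.
  apply/cvgrPdist_le => e e0; rewrite near_withinE.
  have [d d0 hd] := hu e e0.
  apply/nbhs_ballP; exists d => //= h; rewrite /ball /= sub0r normrN => hh h0.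
  have -> : m - h^-1 *: (u (h *: 1 + t) - u t) =
      - (h^-1 * (u (t + h) - u t - h * m)).
    by rewrite /GRing.scale /= mulr1 (addrC h t); field.
  rewrite normrN normrM normfV mulrC ler_pdivrMr ?normr_gt0 //.
  exact: hd.
by apply: DeriveDef; [apply/cvg_ex; exists m | exact: cvg_lim cl].
Qed.

Lemma is_derive_Re_line f a d l (t : R) :
  is_derive (a + t%:C%C * d) 1 f l ->
  is_derive t 1 (fun t : R => complex.Re (f (a + t%:C%C * d)))
    (complex.Re (l * d)).
Proof.
move=> /is_deriveCP df; apply: is_deriveR_of_remainder => e e0.
(* The direction d may be zero, hence the denominator [cabs d + 1]. *)
have d1 : 0 < cabs d + 1 by rewrite ltr_pwDr // cabs_ge0.
have [r r0 hr] := df (e / (cabs d + 1)) (divr_gt0 e0 d1).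
exists (r / (cabs d + 1)); first exact: divr_gt0.
move=> h hh.
have -> : complex.Re (f (a + (t + h)%:C%C * d)) -
    complex.Re (f (a + t%:C%C * d)) - h * complex.Re (l * d) =
  complex.Re (f ((a + t%:C%C * d) + h%:C%C * d) - f (a + t%:C%C * d)
     - (h%:C%C * d) * l).
  rewrite rmorphD mulrDl !addrA -mulrA (mulrC d l) !raddfB /=.
  by congr (_ - _); case: (l * d) => x y /=; rewrite mul0r subr0.
apply: le_trans (normRe_le_cabs _) _.
have hd : cabs (h%:C%C * d) <= `|h| * (cabs d + 1).
  by rewrite cabsM cabs_real; rewrite ler_wpM2l // lerDl.
have hdr : cabs (h%:C%C * d) < r.
  by apply: le_lt_trans hd _; rewrite -ltr_pdivlMr.
apply: le_trans (hr _ hdr) _.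
have -> : e * `|h| = e / (cabs d + 1) * (`|h| * (cabs d + 1)).
  by field; exact: lt0r_neq0.
by apply: ler_wpM2l hd; rewrite ltW // divr_gt0.
Qed.

Lemma is_derive_Im_line f a d l (t : R) :
  is_derive (a + t%:C%C * d) 1 f l ->
  is_derive t 1 (fun t : R => complex.Im (f (a + t%:C%C * d)))
    (complex.Im (l * d)).
Proof.
move=> df.
(* Im w = Re (- i w) reduces the claim to the real part. *)
have dg : is_derive (a + t%:C%C * d) 1 (fun z => (- 'i%C * f z : C)) (- 'i%C * l : C).
  exact: (@is_deriveZ _ _ _ f (- 'i%C) _ _ _ df).
have reI w : complex.Re (- 'i%C * w) = complex.Im w.
  by case: w => x y /=; rewrite oppr0 mul0r sub0r mulN1r opprK.
have := @is_derive_Re_line _ a d _ t dg; rewrite -mulrA reI.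
by under eq_fun do rewrite reI.
Qed.

(** The real mean value theorem is applied along the segment to the real and to the imaginary part;
    each costs [M * cabs (b - a)], whence the factor 2. *)
Lemma mean_value_bound f a b M :
  (forall t : R, 0 <= t <= 1 -> derivable f (a + t%:C%C * (b - a)) 1) ->
  (forall t : R, 0 < t < 1 ->
     exists2 l, is_derive (a + t%:C%C * (b - a)) 1 f l & cabs l <= M) ->
  cabs (f b - f a) <= 2 * M * cabs (b - a).
Proof.
move=> df hM; pose L (t : R) : C := 'D_1 f (a + t%:C%C * (b - a)).
have dL (t : R) : 0 <= t <= 1 -> is_derive (a + t%:C%C * (b - a)) 1 f (L t).
  by move=> /df/derivableP.
have LM (t : R) : 0 < t < 1 -> cabs (L t * (b - a)) <= M * cabs (b - a).
  move=> /hM[l dl lM]; rewrite cabsM ler_wpM2r ?cabs_ge0 //.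
  by rewrite /L (@derive_val _ _ _ _ _ _ _ dl).
have cont (u du : R -> R) : (forall t : R, 0 <= t <= 1 -> is_derive t 1 u (du t)) ->
    {within `[0, 1], continuous u}.
  move=> hu; apply: derivable_within_continuous => t; rewrite in_itv /= => t01.
  by have := hu t t01 => -[].
have a0 : a + 0%:C%C * (b - a) = a by rewrite mul0r addr0.
have a1 : a + 1%:C%C * (b - a) = b by rewrite mul1r addrC subrK.
have bound (u du : R -> R) : (forall t : R, 0 <= t <= 1 -> is_derive t 1 u (du t)) ->
    (forall t : R, 0 < t < 1 -> `|du t| <= M * cabs (b - a)) ->
    `|u 1 - u 0| <= M * cabs (b - a).
  move=> hu hdu; have [||c] := @MVT R u du 0 1 ltr01.
  - by move=> t; rewrite in_itv /= => /andP[t0 t1]; apply: hu; rewrite !ltW.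
  - exact: cont hu.
  by rewrite in_itv /= => c01 ->; rewrite subr0 mulr1; apply: hdu.
have bR := bound _ _ (fun t t01 => is_derive_Re_line (dL t t01))
  (fun t t01 => le_trans (normRe_le_cabs _) (LM t t01)).
have bI := bound _ _ (fun t t01 => is_derive_Im_line (dL t t01))
  (fun t t01 => le_trans (normIm_le_cabs _) (LM t t01)).
apply: le_trans (cabs_le_ReIm _) _.
rewrite -mulrA mulr2n mulrDl !mul1r; move: bR bI; rewrite a0 a1 => bR bI.
by rewrite !raddfB lerD.
Qed.

Lemma derive0_segment f a b :
  (forall t : R, 0 <= t <= 1 -> is_derive (a + t%:C%C * (b - a)) 1 f 0) ->
  f b = f a.
Proof.
move=> df; apply/eqP; rewrite -subr_eq0; apply/eqP/cabs0_eq0/eqP.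
rewrite eq_le cabs_ge0 andbT.
have := @mean_value_bound f a b 0; rewrite mulr0 mul0r; apply.
  by move=> t /df[].
move=> t /andP[t0 t1]; exists 0; last by rewrite cabs0.
by apply: df; rewrite !ltW.
Qed.

(** The mean value bound for f(z) - l z between 0 and a small real t compares the difference
    quotient of f at 0 with l, without continuity of the derivative being known in advance. *)
Lemma derive_limit f (f' : C -> C) l l0 :
  (forall z, z != 0 -> is_derive z 1 f (f' z)) -> is_derive (0 : C) 1 f l0 ->
  (forall e, 0 < e -> exists2 d : R, 0 < d &
     forall z, z != 0 -> cabs z < d -> cabs (f' z - l) <= e) ->
  l = l0.
Proof.
move=> df df0 lim; apply/eqP; rewrite -subr_eq0; apply/eqP.
(* Two thirds of e go to the mean value bound, with its factor 2, and one third to the derivative at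
   0. *)
apply: cabs_small_eq0 => e e0; have e3 : 0 < e / 3 by rewrite divr_gt0.
have [d1 d10 h1] := lim _ e3.
have [d2 d20 h2] := (is_deriveCP _ _ _).1 df0 _ e3.
pose t : R := Num.min d1 d2 / 2.
have m0 : 0 < Num.min d1 d2 by rewrite lt_min d10.
have t0 : 0 < t by rewrite divr_gt0.
have tm : t < Num.min d1 d2 by rewrite /t; lra.
have ct : cabs (t%:C%C : C) = t by rewrite cabs_real gtr0_norm.
have [td1 td2] : t < d1 /\ t < d2 by move: tm; rewrite lt_min => /andP[].
pose g z := f z - l * z.
have dg z l' : is_derive z 1 f l' -> is_derive z 1 g (l' - l).
  move=> dz; apply: is_deriveB.
  rewrite -[X in is_derive _ _ _ X]mulr1.
  exact: (@is_deriveZ _ _ _ id l z 1 1 (is_derive_id _ _)).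
have B : cabs (g t%:C%C - g 0) <= 2 * (e / 3) * t.
  rewrite -{2}ct -{2}(subr0 t%:C%C); apply: mean_value_bound => s.
    have [->|s0] := eqVneq s 0 => _.
      by rewrite mul0r addr0; have [] := dg _ _ df0.
    rewrite add0r subr0 -rmorphM.
    have nz : (s * t)%:C%C != 0 :> C.
      by rewrite -cabs_gt0 cabs_real normr_gt0 mulf_neq0 // lt0r_neq0.
    by have [] := dg _ _ (df _ nz).
  move=> /andP[s0 s1]; rewrite add0r subr0 -rmorphM.
  have nz : (s * t)%:C%C != 0 :> C.
    by rewrite -cabs_gt0 cabs_real normr_gt0 mulf_neq0 // lt0r_neq0.
  exists (f' (s * t)%:C%C - l); first exact: dg _ _ (df _ nz).
  apply: h1 => //; rewrite cabs_real gtr0_norm ?mulr_gt0 //.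
  by apply: lt_trans td1; rewrite gtr_pMl.
have td2' : cabs (t%:C%C : C) < d2 by rewrite ct.
have := h2 _ td2'; rewrite add0r ct => B2.
have : cabs ((l - l0) * t%:C%C) <= e * t.
  have -> : (l - l0) * t%:C%C = (f t%:C%C - f 0 - t%:C%C * l0) - (g t%:C%C - g 0).
    by rewrite /g mulr0 subr0 mulrBl !(mulrC t%:C%C); ring.
  apply: le_trans (cabsB _ _) _; lra.
by rewrite cabsM ct ler_pM2r.
Qed.

(* The derivative of z f(z) at 0 forces Phi 0 = 0; then f' = Phi / z tends to
   the derivative of Phi at 0.                                                *)
Lemma regular_singular_point f (f' Phi : C -> C) l :
  (forall z, is_derive z 1 f (f' z)) ->
  (forall z, z != 0 -> z * f' z = Phi z) -> is_derive (0 : C) 1 Phi l ->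
  Phi 0 = 0 /\ l = f' 0.
Proof.
move=> df eP dPhi.
have lim (u : C -> C) m : is_derive (0 : C) 1 u m -> forall e, 0 < e ->
    exists2 d : R, 0 < d & forall z, z != 0 -> cabs z < d ->
      cabs (u z - u 0) <= e /\ cabs ((u z - u 0) / z - m) <= e.
  move=> /is_deriveCP du e e0; have m1 : 0 < cabs m + e + 1.
    by rewrite addr_gt0 // ltr_wpDl // cabs_ge0.
  have [d d0 hd] := du e e0.
  exists (Num.min d (e / (cabs m + e + 1))); first by rewrite lt_min d0 divr_gt0.
  move=> z z0; rewrite lt_min => /andP[/hd zd]; rewrite add0r in zd.
  rewrite ltr_pdivlMr // => ze; split; last first.
    have -> : (u z - u 0) / z - m = (u z - u 0 - z * m) / z by field.
    by rewrite cabsM cabsV ler_pdivrMr // cabs_gt0.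
  rewrite -(subrK (z * m) (u z - u 0)); apply: le_trans (cabsD _ _) _.
  apply: le_trans (ltW ze); rewrite cabsM; apply: le_trans (lerD zd (lexx _)) _.
  by have := cabs_ge0 z; nra.
have P0 : Phi 0 = 0.
  pose v z := z * f z.
  have dv z : is_derive z 1 v (z * f' z + f z * 1).
    exact: (@is_deriveM _ _ id f z 1 1 (f' z) (is_derive_id _ _) (df z)).
  have : f 0 + Phi 0 = 0 * f' 0 + f 0 * 1.
    apply: (@derive_limit v (fun z => z * f' z + f z * 1)) => // e e0.
    have e2 : 0 < e / 2 by rewrite divr_gt0.
    have [d1 d10 h1] := lim _ _ (df 0) _ e2.
    have [d2 d20 h2] := lim _ _ dPhi _ e2.
    exists (Num.min d1 d2); first by rewrite lt_min d10.
    move=> z z0; rewrite lt_min => /andP[/(h1 _ z0)[b1 _] /(h2 _ z0)[b2 _]].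
    rewrite (eP _ z0).
    have -> : Phi z + f z * 1 - (f 0 + Phi 0) =
      (f z - f 0) + (Phi z - Phi 0) by ring.
    by apply: le_trans (cabsD _ _) _; lra.
  by rewrite mul0r add0r mulr1 -[RHS]addr0 => /addrI.
split=> //; apply: (@derive_limit f f') => // e e0.
have [d d0 hd] := lim _ _ dPhi _ e0; exists d => // z z0 /(hd _ z0)[_].
by rewrite P0 subr0 -eP // mulrC mulKf.
Qed.

End ComplexCalculus.

(** * Limits of sequences, power series and their term-by-term differentiation *)

Section SequenceLimits.
Variable K : numFieldType.
Implicit Types (u v : nat -> K) (l m c : K).

Lemma cvg_sub u v l m : u @ \oo --> l -> v @ \oo --> m ->
  (fun n => u n - v n) @ \oo --> l - m.
Proof. exact: cvgB. Qed.

Lemma cvg_scale c u l : u @ \oo --> l -> (fun n => c * u n) @ \oo --> c * l.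
Proof. exact: cvgMl_tmp. Qed.

Lemma cvg_sum_ord n (F : 'I_n -> nat -> K) (L : 'I_n -> K) :
  (forall i, F i @ \oo --> L i) ->
  (fun k => \sum_(i < n) F i k) @ \oo --> \sum_(i < n) L i.
Proof.
elim: n F L => [|n IH] F L FL.
  by under eq_fun do rewrite big_ord0; rewrite big_ord0; exact: cvg_cst.
under eq_fun do rewrite big_ord_recl; rewrite big_ord_recl.
by apply: cvgD; [exact: FL | apply: IH => i; exact: FL].
Qed.

Lemma cvg_seq_unique u l m : u @ \oo --> l -> u @ \oo --> m -> l = m.
Proof.
move=> ul um; rewrite -(cvg_lim (@norm_hausdorff _ _) ul).
exact: (cvg_lim (@norm_hausdorff _ _) um).
Qed.

(** Recursion in k for the second-order Taylor remainder of [z ^+ k]. The truncated predecessor is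
    harmless at k = 0, where the factor [*+ k] kills the term. *)
Lemma powers_remainderS (z h : K) k :
  (z + h) ^+ k.+1 - z ^+ k.+1 - h * (z ^+ k.+1.-1 *+ k.+1) =
  (z + h) * ((z + h) ^+ k - z ^+ k - h * (z ^+ k.-1 *+ k)) +
    h ^+ 2 * (z ^+ k.-1 *+ k).
Proof.
case: k => [|k] /=; first by rewrite !expr0 !expr1 mulr0n mulr1n; ring.
rewrite -(mulr_natl (z ^+ k.+1)) -(mulr_natl (z ^+ k)) -(natr1 k.+1) !exprS.
by move: (k.+1%:R) (z ^+ k) ((z + h) ^+ k) => c u v; ring.
Qed.

Lemma powers_remainder_coef (z h c : K) k :
  ((z + h) ^+ k - z ^+ k - h * (z ^+ k.-1 *+ k)) * c =
  (z + h) ^+ k * c - z ^+ k * c - h * (z ^+ k.-1 * (c *+ k)).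
Proof.
rewrite -(mulr_natl (z ^+ k.-1)) -(mulr_natl c).
by move: (z ^+ k.-1) ((z + h) ^+ k) (z ^+ k) => u v w; ring.
Qed.

End SequenceLimits.

Section ComplexSeries.
Variable R : realType.
Notation C := (Num.NumField.sort (R[i] : numFieldType)).
Implicit Types (a : nat -> C) (z w l : C) (B M e : R).

Lemma cabs_limit_le (u : nat -> C) l B :
  u @ \oo --> l -> (\forall n \near \oo, cabs (u n) <= B) -> cabs l <= B.
Proof.
move=> /cvgCP ul uB; apply/ler_addgt0Pl => e e0.
near \oo => n.
rewrite -(subrK (u n) l); apply: le_trans (cabsD _ _) _; apply: lerD.
  by apply: ltW; near: n; exact: ul.
by near: n.
Unshelve. all: by end_near. Qed.

Lemma cvg_series_bounded a l : series a @ \oo --> l ->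
  exists B, forall k, cabs (a k) <= B.
Proof.
move=> /cvgCP/(_ _ ltr01)[N _ hN].
(* From N on a term is the difference of two partial sums, each within 1 of the limit; the earlier
   terms are covered by the finite sum. *)
exists (2 + \sum_(k < N) cabs (a k)) => k.
have [Nk|kN] := leqP N k.
  have -> : a k = (l - series a k) - (l - series a k.+1).
    by rewrite /series /= big_nat_recr //=; ring.
  apply: le_trans (cabsB _ _) _.
  have h1 := ltW (hN _ Nk); have h2 := ltW (hN _ (leqW Nk)).
  apply: le_trans (lerD h1 h2) _.
  by rewrite -[1 + 1]/2 lerDl sumr_ge0 // => i _; exact: cabs_ge0.
rewrite (bigD1 (Ordinal kN)) //= addrCA lerDl addr_ge0 //.
by rewrite sumr_ge0 // => i _; exact: cabs_ge0.
Qed.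

Lemma sum_halves_le B n m : 0 <= B ->
  \sum_(n <= k < m) B / 2 ^+ k <= 2 * B / 2 ^+ n.
Proof.
move=> B0; have [mn|nm] := leqP m n.
  by rewrite big_geq // divr_ge0 ?mulr_ge0 ?exprn_ge0.
(* The sum telescopes, since B / 2^k = 2 B / 2^k - 2 B / 2^(k+1). *)
suff -> : \sum_(n <= k < m) B / 2 ^+ k = 2 * B / 2 ^+ n - 2 * B / 2 ^+ m.
  by rewrite gerBl divr_ge0 ?mulr_ge0 ?exprn_ge0.
rewrite -opprB -(telescope_sumr (fun k => 2 * B / 2 ^+ k) (ltnW nm)) -sumrN.
by apply: eq_bigr => k _; rewrite exprS; field; rewrite expf_neq0 ?pnatr_eq0.
Qed.

Lemma series_geometric_tail a l B n :
  (forall k, cabs (a k) <= B / 2 ^+ k) -> series a @ \oo --> l ->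
  cabs (l - series a n) <= 2 * B / 2 ^+ n.
Proof.
move=> aB al; have B0 : 0 <= B.
  by apply: le_trans (cabs_ge0 (a 0%N)) _; have := aB 0%N; rewrite expr0 divr1.
apply: (@cabs_limit_le (fun m => series a m - series a n)).
  by apply: cvg_sub al _; exact: cvg_cst.
exists n => // m /= nm.
rewrite sub_series_geq //; apply: le_trans (cabs_sum _ _ _) _.
by apply: le_trans (sum_halves_le n m B0); apply: ler_sum.
Qed.

Lemma series_geometric_cvg a B :
  (forall k, cabs (a k) <= B / 2 ^+ k) -> cvgn (series a).
Proof.
move=> aB; have cvgR (u : nat -> R) : (forall k, `|u k| <= cabs (a k)) ->
    cvgn (series u).
  move=> ua; apply: normed_cvg.
  have B0 k : 0 <= B / 2 ^+ k by exact: le_trans (cabs_ge0 _) (aB k).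
  have uB k : `|u k| <= B / 2 ^+ k by exact: le_trans (ua k) (aB k).
  apply: (series_le_cvg (fun k => normr_ge0 (u k)) B0 uB).
  - have := @is_cvg_geometric_series R B 2^-1.
    rewrite gtr0_norm ?invr_gt0 // invf_lt1 // ltr1n => /(_ isT).
    by rewrite /geometric; under eq_fun do rewrite exprVn.
have cR := cvgR _ (fun k => normRe_le_cabs (a k)).
have cI := cvgR _ (fun k => normIm_le_cabs (a k)).
apply/cvg_ex; exists ((limn (series (fun k => complex.Re (a k)))) +i*
  (limn (series (fun k => complex.Im (a k)))))%C.
apply/cvgCP => e e0; have e2 : 0 < e / 2 by rewrite divr_gt0.
move: cR cI => /cvgrPdist_lt/(_ _ e2) cR /cvgrPdist_lt/(_ _ e2) cI.
near=> n; apply: le_lt_trans (cabs_le_ReIm _) _; rewrite !raddfB /= (splitr e).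
rewrite ltrD //.
  by rewrite /series /= raddf_sum; near: n.
by rewrite /series /= raddf_sum; near: n.
Unshelve. all: by end_near. Qed.

(** Convergence at the point 2 M bounds the terms there; returning to radius M gains the factor
    2^-k. Every geometric domination of an entire series below comes from this doubling. *)
Lemma powerseries_geometric a (f : C -> C) M :
  (forall z, series (fun k => z ^+ k * a k) @ \oo --> f z) -> 0 < M ->
  exists B, forall k, cabs (a k) * M ^+ k <= B / 2 ^+ k.
Proof.
move=> af M0; have [B hB] := cvg_series_bounded (af (2 * M)%:C%C).
exists B => k; rewrite ler_pdivlMr ?exprn_gt0 //.
apply: le_trans (hB k); rewrite cabsM cabsX cabs_real gtr0_norm ?mulr_gt0 //.
by rewrite exprMn le_eqVlt; apply/orP; left; apply/eqP; ring.
Qed.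

Lemma series_at0 a : series (fun k => 0 ^+ k * a k) @ \oo --> a 0%N.
Proof.
apply/cvgCP => e e0; exists 1%N => // -[//|n] _ /=.
rewrite /series /= big_nat_recl //= expr0 mul1r big1 ?addr0 ?subrr ?cabs0 //.
by move=> k _; rewrite exprS !mul0r.
Qed.

Lemma powerseries_at0 a (f : C -> C) :
  (forall z, series (fun k => z ^+ k * a k) @ \oo --> f z) -> f 0 = a 0%N.
Proof. by move=> af; exact: (cvg_seq_unique (af 0) (@series_at0 a)). Qed.

(** Induction on the recursion for the remainder: the step needs k^2 + k <= (k + 1)^2, and 1 <= M
    lets M^k be replaced by M^(k+1). *)
Lemma powerseries_remainder M z h k : 1 <= M -> cabs z <= M ->
  cabs (z + h) <= M ->
  cabs ((z + h) ^+ k - z ^+ k - h * (z ^+ k.-1 *+ k)) <=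
    cabs h ^+ 2 * (k%:R ^+ 2 * M ^+ k).
Proof.
move=> M1 zM zhM; have M0 : 0 <= M by apply: le_trans M1.
elim: k => [|k IH].
  by rewrite !expr0 mulr0n mulr0 subr0 subrr cabs0 expr0n !mul0r mulr0.
rewrite powers_remainderS.
apply: le_trans (cabsD _ _) _; rewrite (cabsM (z + h)) (cabsM (h ^+ 2)) cabsX.
have zk : cabs (z ^+ k.-1 *+ k) <= k%:R * M ^+ k.
  rewrite -mulr_natl cabsM cabs_nat cabsX.
  case: k {IH} => [|k] /=; first by rewrite !mul0r.
  rewrite ler_wpM2l //; apply: (@le_trans _ _ (M ^+ k)).
    by rewrite lerXn2r // nnegrE ?cabs_ge0.
  by rewrite exprS ler_peMl // exprn_ge0.
have h1 : cabs (z + h) * cabs ((z + h) ^+ k - z ^+ k - h * (z ^+ k.-1 *+ k))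
   <= M * (cabs h ^+ 2 * (k%:R ^+ 2 * M ^+ k)).
  by apply: ler_pM => //; exact: cabs_ge0.
have h2 : cabs h ^+ 2 * cabs (z ^+ k.-1 *+ k) <= cabs h ^+ 2 * (k%:R * M ^+ k).
  by apply: ler_wpM2l zk; rewrite exprn_ge0 // cabs_ge0.
apply: le_trans (lerD h1 h2) _.
have -> : M * (cabs h ^+ 2 * (k%:R ^+ 2 * M ^+ k)) =
  cabs h ^+ 2 * (k%:R ^+ 2 * M ^+ k.+1) by rewrite (exprS M); ring.
rewrite -mulrDr ler_wpM2l ?exprn_ge0 ?cabs_ge0 //.
have h3 : k%:R * M ^+ k <= k%:R * M ^+ k.+1.
  by rewrite ler_wpM2l // exprS ler_peMl // exprn_ge0.
apply: le_trans (lerD (lexx _) h3) _; rewrite -mulrDl ler_wpM2r ?exprn_ge0 //.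
by rewrite -natr1; have : 0 <= k%:R :> R by []; nra.
Qed.

Lemma sqr_le_4exp2 k : k%:R ^+ 2 <= 4 * 2 ^+ k :> R.
Proof.
(* Strengthened to be inductive: doubling the left side at k dominates its value at k + 1. *)
suff : k%:R ^+ 2 + 2 * k%:R + 3 <= 4 * 2 ^+ k :> R.
  by have : 0 <= k%:R :> R by []; lra.
elim: k => [|k IH]; first by rewrite expr0; lra.
by rewrite -natr1 (exprS 2); have : 0 <= k%:R :> R by []; nra.
Qed.

(** The second-order remainders of the monomials sum to at most a constant times |h|^2. In the
    constant [8 * |B|], the 4 comes from k^2 <= 4 2^k and the 2 from the geometric tail. *)
Lemma is_derive_powerseries a (f : C -> C) z l :
  (forall w, series (fun k => w ^+ k * a k) @ \oo --> f w) ->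
  series (fun k => z ^+ k * (a k.+1 *+ k.+1)) @ \oo --> l ->
  is_derive z 1 f l.
Proof.
move=> af zl; pose M := cabs z + 1.
have M1 : 1 <= M by rewrite lerDr cabs_ge0.
have M0 : 0 < M by apply: lt_le_trans M1.
(* With radius 2 M, one factor 2^k absorbs k^2 and another remains for geometric convergence. *)
have [B hB] := powerseries_geometric af (mulr_gt0 (ltr0Sn _ 1) M0).
have rem h : cabs h <= 1 ->
    cabs (f (z + h) - f z - h * l) <= 8 * `|B| * cabs h ^+ 2.
  move=> h1; have zh : cabs (z + h) <= M.
    by apply: le_trans (cabsD _ _) _; rewrite lerD2l.
  have zM : cabs z <= M by rewrite lerDl.
  have dl : series (fun k => z ^+ k.-1 * (a k *+ k)) @ \oo --> l.
    apply/cvgCP => e e0; have /cvgCP/(_ _ e0)[N _ hN] := zl.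
    exists N.+1 => // -[//|n] /= Nn; have := hN n Nn.
    by rewrite /series /= big_nat_recl //= mulr0n mulr0 add0r.
  pose r k := ((z + h) ^+ k - z ^+ k - h * (z ^+ k.-1 *+ k)) * a k.
  have rl : series r @ \oo --> f (z + h) - f z - h * l.
    have -> : series r = (fun n => series (fun k => (z + h) ^+ k * a k) n -
        series (fun k => z ^+ k * a k) n
        - h * series (fun k => z ^+ k.-1 * (a k *+ k)) n).
      apply/funext => n; rewrite /series /= mulr_sumr -!sumrB.
      by apply: eq_bigr => k _; exact: powers_remainder_coef.
    have hl := cvg_sub (cvg_sub (af (z + h)) (af z)) (@cvg_scale _ h _ _ dl).
    exact: hl.
  have rB k : cabs (r k) <= (4 * `|B| * cabs h ^+ 2) / 2 ^+ k.
    rewrite cabsM; have := powerseries_remainder k M1 zM zh.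
    move=> /(ler_wpM2r (cabs_ge0 (a k))); move/le_trans; apply.
    have -> : 4 * `|B| * cabs h ^+ 2 / 2 ^+ k =
      cabs h ^+ 2 * (4 * (`|B| / 2 ^+ k)) by ring.
    have -> : cabs h ^+ 2 * (k%:R ^+ 2 * M ^+ k) * cabs (a k) =
      cabs h ^+ 2 * (k%:R ^+ 2 * (M ^+ k * cabs (a k))) by ring.
    apply: ler_wpM2l; first by rewrite exprn_ge0 ?cabs_ge0.
    have Bk : B / 2 ^+ k <= `|B| / 2 ^+ k.
      by rewrite ler_wpM2r ?invr_ge0 ?exprn_ge0 // ler_norm.
    have := le_trans (hB k) Bk; rewrite exprMn => hBk.
    have q0 : 0 <= M ^+ k * cabs (a k).
      by rewrite mulr_ge0 ?cabs_ge0 // exprn_ge0 // ltW.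
    apply: le_trans (ler_wpM2r q0 (sqr_le_4exp2 k)) _.
    rewrite -mulrA ler_wpM2l //.
    by have -> : 2 ^+ k * (M ^+ k * cabs (a k)) = cabs (a k) * (2 ^+ k * M ^+ k)
      by ring.
  have := series_geometric_tail 0 rB rl.
  rewrite /series /= big_geq // subr0 expr0 divr1 => /le_trans; apply.
  by rewrite !mulrA -natrM.
apply/is_deriveCP => e e0; have B1 : 0 < 8 * `|B| + 1 by rewrite ltr_wpDl ?mulr_ge0.
exists (Num.min 1 (e / (8 * `|B| + 1))); first by rewrite lt_min ltr01 divr_gt0.
move=> h; rewrite lt_min ltr_pdivlMr // => /andP[h1 he].
apply: le_trans (rem _ (ltW h1)) _; rewrite expr2 mulrA ler_wpM2r ?cabs_ge0 //.
by have := cabs_ge0 h; nra.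
Qed.

End ComplexSeries.

(** * The exponential and Cauchy's estimate *)

Section ComplexExponential.
Variable R : realType.
Notation C := (Num.NumField.sort (R[i] : numFieldType)).
Implicit Types (z w l : C) (x y e : R).

Lemma cexp0 : cexp 0 = 1 :> C.
Proof. by rewrite /cexp /= expR0 cos0 sin0 mulr1 mulr0. Qed.

Lemma cexpD z w : cexp (z + w) = cexp z * cexp w :> C.
Proof.
case: z w => [a b] [c d]; apply/eqP; rewrite eq_complex /= expRD cosD sinD.
by apply/andP; split; apply/eqP; ring.
Qed.

Lemma cexpN z : cexp (- z) * cexp z = 1 :> C.
Proof. by rewrite -cexpD addNr cexp0. Qed.

Lemma cexp_neq0 z : cexp z != 0 :> C.
Proof.
apply/eqP => z0; have := cexpN z; rewrite z0 mulr0 => /eqP.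
by rewrite eq_sym oner_eq0.
Qed.

Lemma cexpMn z n : cexp (z *+ n) = cexp z ^+ n :> C.
Proof.
by elim: n => [|n IH]; rewrite ?mulr0n ?cexp0 // mulrS cexpD IH exprS.
Qed.

Lemma cabs_cexp z : cabs (cexp z) = expR (complex.Re z).
Proof.
rewrite /cabs normc_def /= !exprMn -mulrDr cos2Dsin2 mulr1 sqrtr_sqr.
by rewrite ger0_norm // expR_ge0.
Qed.

Lemma is_deriveR_remainder (u : R -> R) (m e : R) : is_derive (0 : R) 1 u m ->
  0 < e -> exists2 d : R, 0 < d & forall h : R, `|h| < d ->
    `|u h - u 0 - h * m| <= e * `|h|.
Proof.
move=> [du dm] e0.
have : (fun h => h^-1 *: ((u \o shift 0) (h *: 1) - u 0)) @ 0^' --> m.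
  by rewrite -dm; exact: du.
move=> /cvgrPdist_le/(_ _ e0); rewrite near_withinE => /nbhs_ballP[d /= d0 hd].
exists d => // h hh; have [->|h0] := eqVneq h 0.
  by rewrite subrr mul0r subr0 normr0 mulr0.
have bh : ball (0 : R) d h by rewrite /ball /= sub0r normrN.
have := hd h bh h0.
have -> : m - h^-1 *: ((u \o shift 0) (h *: 1) - u 0) =
    - (h^-1 * (u h - u 0 - h * m)).
  by rewrite /GRing.scale /= mulr1 addr0; field.
by rewrite normrN normrM normfV mulrC ler_pdivrMr ?normr_gt0.
Qed.

(** The functional equation reduces the claim to z = 0, where the first-order expansions of exp, cos
    and sin over the reals suffice. *)
Lemma is_derive_cexp z : is_derive z 1 (@cexp R : C -> C) (cexp z).
Proof.
suff H e : 0 < e -> exists2 d : R, 0 < d &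
    forall h : C, cabs h < d -> cabs (cexp h - 1 - h) <= e * cabs h.
  apply/is_deriveCP => e e0; have z0 : 0 < cabs (cexp z).
    by rewrite cabs_gt0 cexp_neq0.
  have [d d0 hd] := H _ (divr_gt0 e0 z0); exists d => // h /hd.
  have -> : cexp (z + h) - cexp z - h * cexp z =
    cexp z * (cexp h - 1 - h) by rewrite cexpD; ring.
  rewrite cabsM -(ler_pM2l z0) => /le_trans; apply.
  by rewrite mulrA mulrCA divff ?mulr1 // lt0r_neq0.
(* The real and imaginary parts cost at most 3 r |h| each and the product x y at most |h|^2, with r
   and |h| bounded by e / 8: in all 7/8 of e |h|. *)
move=> e0; have e8 : 0 < Num.min 1 (e / 8) by rewrite lt_min ltr01 divr_gt0.
have [d1 d10 h1] := is_deriveR_remainder (is_derive_expR 0) e8.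
have [d2 d20 h2] := is_deriveR_remainder (is_derive_cos 0) e8.
have [d3 d30 h3] := is_deriveR_remainder (is_derive_sin 0) e8.
move: h1 h2 h3; set r := Num.min 1 _ => h1 h2 h3.
have r1 : r <= 1 by rewrite ge_min lexx.
have re : r <= e / 8 by rewrite ge_min lexx orbT.
exists (Num.min (Num.min d1 (Num.min d2 d3)) (Num.min (1 / 2) (e / 8))).
  by rewrite !lt_min d10 d20 d30 /= !divr_gt0.
move=> [x y]; set h := (x +i* y)%C.
rewrite !lt_min => /andP[/andP[hd1 /andP[hd2 hd3]] /andP[hh he]].
have xh : `|x| <= cabs h := normRe_le_cabs h.
have yh : `|y| <= cabs h := normIm_le_cabs h.
have := h1 x (le_lt_trans xh hd1); rewrite expR0 mulr1 => bx.
have := h2 y (le_lt_trans yh hd2); rewrite sin0 cos0 oppr0 mulr0 subr0 => bc.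
have := h3 y (le_lt_trans yh hd3); rewrite sin0 cos0 subr0 mulr1 => bs.
apply: le_trans (cabs_le_ReIm _) _; rewrite /h /=.
have -> : expR x * cos y - 1 - x = expR x * (cos y - 1) + (expR x - 1 - x) by ring.
have -> : expR x * sin y - 0 - y = expR x * (sin y - y) + (expR x - 1 - x) * y + x * y
  by ring.
have ex : expR x <= 2.
  have : `|expR x - 1 - x| <= cabs h.
    by apply: le_trans bx _; apply: le_trans xh; rewrite ler_piMl.
  have := ler_norm (expR x - 1 - x); have := ler_norm x; lra.
have ex0 := expR_ge0 x.
have A1 : `|expR x * (cos y - 1) + (expR x - 1 - x)| <= 3 * (r * cabs h).
  apply: le_trans (ler_normD _ _) _; rewrite normrM (ger0_norm ex0).
  have : expR x * `|cos y - 1| <= 2 * (r * cabs h).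
    apply: ler_pM => //; apply: le_trans bc _; apply: ler_wpM2l yh.
    exact: ltW.
  have : `|expR x - 1 - x| <= r * cabs h.
    by apply: le_trans bx _; apply: ler_wpM2l xh; exact: ltW.
  lra.
have A2 : `|expR x * (sin y - y) + (expR x - 1 - x) * y + x * y| <=
    3 * (r * cabs h) + cabs h * cabs h.
  apply: le_trans (ler_normD _ _) _.
  have : `|x * y| <= cabs h * cabs h by rewrite normrM ler_pM.
  suff : `|expR x * (sin y - y) + (expR x - 1 - x) * y| <= 3 * (r * cabs h) by lra.
  apply: le_trans (ler_normD _ _) _; rewrite !normrM (ger0_norm ex0).
  have : expR x * `|sin y - y| <= 2 * (r * cabs h).
    apply: ler_pM => //; apply: le_trans bs _; apply: ler_wpM2l yh.
    exact: ltW.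
  have : `|expR x - 1 - x| * `|y| <= r * cabs h * 1.
    apply: ler_pM => //; last by lra.
    by apply: le_trans bx _; apply: ler_wpM2l xh; exact: ltW.
  lra.
apply: le_trans (lerD A1 A2) _; have := cabs_ge0 h; nra.
Qed.

End ComplexExponential.

(** * Cauchy's estimate in degree 1, by averaging over roots of unity *)

Section CauchyEstimate.
Variable R : realType.
Notation C := (Num.NumField.sort (R[i] : numFieldType)).

Definition root_of_unity n : C := cexp (0 +i* (2 * pi / n%:R))%C.

Lemma root_of_unityX n k :
  root_of_unity n ^+ k = cexp (0 +i* (2 * pi / n%:R * k%:R))%C :> C.
Proof.
rewrite -cexpMn; congr cexp; apply/eqP; rewrite eq_complex.
by rewrite !raddfMn /= mul0rn eqxx mulr_natr eqxx.
Qed.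

Lemma root_of_unity_order n : (0 < n)%N -> root_of_unity n ^+ n = 1.
Proof.
move=> n0; rewrite root_of_unityX divfK ?pnatr_eq0 -?lt0n //.
by rewrite /cexp /= expR0 !mul1r mulr_natl cos2pi sin2pi.
Qed.

(** The real part of the power is cos t = 2 cos^2 (t/2) - 1, which is 1 only if sin (t/2) = 0; but
    t/2 = pi k/n lies strictly between 0 and pi. *)
Lemma root_of_unityX_neq1 n k : (0 < k < n)%N -> root_of_unity n ^+ k != 1.
Proof.
move=> /andP[k0 kn]; have n0 : (0 < n)%N by apply: leq_trans kn.
rewrite root_of_unityX; set t := (_ * _); have tE : t = (t / 2) *+ 2.
  by rewrite -mulr_natr divfK.
rewrite /cexp eq_complex /= expR0 !mul1r negb_and; apply/orP; left.
rewrite tE cos_mulr2n.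
have s0 : 0 < sin (t / 2).
  have -> : t / 2 = pi * (k%:R / n%:R).
    by rewrite /t; field; rewrite pnatr_eq0 -lt0n.
  apply: sin_gt0_pi; rewrite mulr_gt0 ?pi_gt0 ?divr_gt0 ?ltr0n //=.
  by rewrite gtr_pMr ?pi_gt0 // ltr_pdivrMr ?ltr0n // mul1r ltr_nat.
have := cos2Dsin2 (t / 2); apply: contra_eq_neq => /eqP ct.
by move: ct; apply: contra_eqN => /eqP ct; apply/eqP; nra.
Qed.

(** A geometric sum whose ratio is an n-th root of unity other than 1. Dividing by
    [root_of_unity n], instead of lowering the exponent, covers k = 0. *)
Lemma root_of_unity_sum n k : (k < n)%N -> k != 1%N -> (1 < n)%N ->
  \sum_(j < n) (root_of_unity n ^+ k / root_of_unity n) ^+ j = 0.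
Proof.
move=> kn k1 n1; set w := _ / _; have n0 : (0 < n)%N by apply: ltnW.
have u0 : root_of_unity n != 0 by exact: cexp_neq0.
have w1 : w != 1.
  rewrite /w; case: k kn k1 {w} => [_ _|[//|k] kn _].
    rewrite expr0 mul1r invr_eq1 -[X in X != _]expr1.
    exact: root_of_unityX_neq1.
  rewrite exprSr mulfK //; apply: root_of_unityX_neq1.
  by rewrite /= (leq_trans _ kn).
have := subrX1 w n; rewrite exprMn exprVn exprAC root_of_unity_order //.
rewrite expr1n mul1r invr1 subrr => /esym/eqP.
by rewrite mulf_eq0 subr_eq0 (negPf w1) => /eqP.
Qed.

(* Averaging the partial sum of degree < n against the n-th roots of unity    *)
(* isolates its coefficient of degree 1.                                      *)
Lemma partial_sum_coef1 (c : nat -> C) (r : C) n : (1 < n)%N ->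
  \sum_(j < n) (\sum_(k < n) (r * root_of_unity n ^+ j) ^+ k * c k)
     / root_of_unity n ^+ j = n%:R * (r * c 1%N).
Proof.
move=> n1; under eq_bigr do rewrite mulr_suml.
rewrite exchange_big /= (bigD1 (Ordinal n1)) //= [X in _ + X]big1 ?addr0.
  transitivity (\sum_(j < n) r * c 1%N); last first.
    by rewrite sumr_const card_ord mulr_natl.
  apply: eq_bigr => j _; rewrite expr1.
  by field; rewrite expf_neq0 // cexp_neq0.
move=> k k1; transitivity (r ^+ k * c k *
    \sum_(j < n) (root_of_unity n ^+ k / root_of_unity n) ^+ j).
  rewrite mulr_sumr; apply: eq_bigr => j _.
  rewrite !exprMn exprVn exprAC; ring.
by rewrite root_of_unity_sum ?mulr0.
Qed.

(** On the circle a partial sum of degree < n exceeds [M] by at most the tail [2 * B / 2 ^+ n]. Its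
    average against the n-th roots of unity is rho c_1, so this bounds rho |c_1|, and n tends to
    infinity. *)
Lemma cauchy_coef1 (c : nat -> C) (p : C -> C) (rho M : R) :
  (forall z : C, series (fun k => z ^+ k * c k) @ \oo --> p z) -> 0 < rho ->
  (forall z : C, cabs z = rho -> cabs (p z) <= M) -> cabs (c 1%N) <= M / rho.
Proof.
move=> cp rho0 pM; have [B hB] := powerseries_geometric cp rho0.
have tail n z : cabs z = rho ->
    cabs (series (fun k => z ^+ k * c k) n) <= M + 2 * B / 2 ^+ n.
  move=> zr; have hB' k : cabs (z ^+ k * c k) <= B / 2 ^+ k.
    by rewrite cabsM cabsX zr mulrC.
  have := series_geometric_tail n hB' (cp z).
  rewrite -[X in cabs X <= M + _](subKr (p z)) => h.
  by apply: le_trans (cabsB _ _) (lerD _ h); exact: pM.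
have step n : (1 < n)%N -> cabs (c 1%N) * rho <= M + 2 * B / 2 ^+ n.
  move=> n1; have n0 : 0 < n%:R :> R by rewrite ltr0n ltnW.
  rewrite -(ler_pM2l n0).
  have -> : n%:R * (cabs (c 1%N) * rho) =
      cabs (n%:R * (rho%:C%C * c 1%N)).
    by rewrite !cabsM cabs_nat cabs_real gtr0_norm //; ring.
  rewrite -partial_sum_coef1 //; apply: le_trans (cabs_sum _ _ _) _.
  have -> : n%:R * (M + 2 * B / 2 ^+ n) = \sum_(j < n) (M + 2 * B / 2 ^+ n).
    by rewrite sumr_const card_ord mulr_natl.
  apply: ler_sum => j _; have uj : cabs (root_of_unity n ^+ j) = 1.
    by rewrite cabsX cabs_cexp /= expR0 expr1n.
  rewrite cabsM cabsV uj invr1 mulr1.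
  have := tail n (rho%:C%C * root_of_unity n ^+ j).
  rewrite cabsM uj cabs_real gtr0_norm // mulr1 => /(_ erefl).
  by rewrite /series /= big_mkord.
rewrite ler_pdivlMr //; apply/ler_addgt0Pl => e e0.
have B0 : 0 <= B.
  by apply: le_trans (cabs_ge0 (c 0%N)) _; have := hB 0%N; rewrite !expr0 mulr1 divr1.
have [n n1 hn] : exists2 n, (1 < n)%N & 2 * B <= e * 2 ^+ n.
  exists (Num.bound (2 * B / e)).+2 => //.
  rewrite (mulrC e) -ler_pdivrMr //.
  have b0 : 0 <= 2 * B / e by rewrite divr_ge0 ?mulr_ge0 // ltW.
  apply: le_trans (ltW (archi_boundP b0)) _.
  rewrite -natrX ler_nat; apply: ltnW; apply: leq_trans (ltn_expl _ _) => //.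
  by rewrite leqW.
apply: le_trans (step n n1) _; rewrite addrC lerD2r ler_pdivrMr ?exprn_gt0 //.
Qed.

End CauchyEstimate.

(** * Differentiation and exponential of matrices *)

Section MatrixDerivative.
Variable K : numFieldType.

Definition mx_is_derive m n (F : K -> 'M[K]_(m, n)) (z : K) (F' : 'M[K]_(m, n)) :=
  forall i j, is_derive z 1 (fun w => F w i j) (F' i j).

Lemma mx_is_deriveE m n (F : K -> 'M[K]_(m, n)) z F' :
  mx_is_derive F z F' -> mxderive F z = F'.
Proof.
move=> dF; apply/matrixP => i j; rewrite mxE derive1E.
by have := dF i j => -[].
Qed.

Lemma mx_is_derive_eq m n (F : K -> 'M[K]_(m, n)) z F' G' :
  mx_is_derive F z F' -> F' = G' -> mx_is_derive F z G'.
Proof. by move=> ? <-. Qed.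

Lemma mx_is_derive_mxderive m n (F : K -> 'M[K]_(m, n)) z :
  (forall i j, derivable (fun w => F w i j) z 1) ->
  mx_is_derive F z (mxderive F z).
Proof. by move=> dF i j; rewrite mxE derive1E; exact: derivableP. Qed.

Lemma mx_is_derive_derivable m n (F : K -> 'M[K]_(m, n)) z F' :
  mx_is_derive F z F' -> forall i j, derivable (fun w => F w i j) z 1.
Proof. by move=> dF i j; have [] := dF i j. Qed.

Lemma mx_is_derive_cst m n (A : 'M[K]_(m, n)) z : mx_is_derive (fun=> A) z 0.
Proof. by move=> i j; rewrite mxE; exact: is_derive_cst. Qed.

Lemma mx_is_deriveD m n (F G : K -> 'M[K]_(m, n)) z F' G' :
  mx_is_derive F z F' -> mx_is_derive G z G' ->
  mx_is_derive (fun w => F w + G w) z (F' + G').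
Proof.
move=> dF dG i j; rewrite mxE; under eq_fun do rewrite mxE.
exact: (is_deriveD (dF i j) (dG i j)).
Qed.

Lemma is_derive_sumfun n (h : 'I_n -> K -> K) (z : K) (dh : 'I_n -> K) :
  (forall i, is_derive z 1 (h i) (dh i)) ->
  is_derive z 1 (fun w => \sum_(i < n) h i w) (\sum_(i < n) dh i).
Proof.
move=> dhi; have -> : (fun w => \sum_(i < n) h i w) = \sum_(i < n) h i.
  by apply/funext => w; rewrite fct_sumE.
exact: is_derive_sum.
Qed.

Lemma mx_is_deriveM m n p (F : K -> 'M[K]_(m, n)) (G : K -> 'M[K]_(n, p))
    z F' G' :
  mx_is_derive F z F' -> mx_is_derive G z G' ->
  mx_is_derive (fun w => F w *m G w) z (F' *m G z + F z *m G').
Proof.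
move=> dF dG i j; rewrite !mxE -big_split /=; under eq_fun do rewrite mxE.
apply: is_derive_sumfun => k; rewrite addrC.
rewrite [X in _ + X]mulrC.
exact: (is_deriveM (dF i k) (dG k j)).
Qed.

Lemma mx_is_deriveZ m n (c : K -> K) (F : K -> 'M[K]_(m, n)) (z c' : K) F' :
  is_derive z 1 c c' -> mx_is_derive F z F' ->
  mx_is_derive (fun w => c w *: F w) z (c' *: F z + c z *: F').
Proof.
move=> dc dF i j; rewrite !mxE; under eq_fun do rewrite mxE.
by rewrite addrC [X in _ + X]mulrC; exact: (is_deriveM dc (dF i j)).
Qed.

Lemma is_derive_is_diff (f : K -> K) (z l : K) :
  is_derive z 1 f l <-> is_diff z f (fun h => h *: l).
Proof.
split=> [[df dl]|[df dl]].
  by split; [exact/derivable1_diffP | rewrite deriv1E // derive1E dl].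
have df' := (derivable1_diffP _ _).2 df.
split=> //; have := deriv1E df'; rewrite dl => /(congr1 (fun u => u 1)).
by rewrite !scale1r derive1E => ->.
Qed.

Lemma is_derive_compose (f g : K -> K) (z l m : K) :
  is_derive (g z) 1 f m -> is_derive z 1 g l ->
  is_derive z 1 (fun w => f (g w)) (l * m).
Proof.
move=> /is_derive_is_diff df /is_derive_is_diff dg; apply/is_derive_is_diff.
have -> : (fun h : K => h *: (l * m)) =
    (fun h : K => h *: m) \o (fun h : K => h *: l).
  by apply/funext => h; rewrite /GRing.scale /= mulrA.
exact: (is_diff_comp dg df).
Qed.

Lemma mx_is_derive_compose m n (F : K -> 'M[K]_(m, n)) (g : K -> K) (z l : K) F' :
  mx_is_derive F (g z) F' -> is_derive z 1 g l ->
  mx_is_derive (fun w => F (g w)) z (l *: F').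
Proof. by move=> dF dg i j; rewrite mxE; exact: (is_derive_compose (dF i j) dg). Qed.

(* Variation of constants, with the inverse of X used only through its        *)
(* differentiability.                                                         *)
Lemma variation_of_constants n p (X Xi : K -> 'M[K]_n) (Y : K -> 'M[K]_(n, p))
    z X' Y' V :
  (\forall w \near z, Xi w *m X w = 1%:M) -> mx_is_derive X z X' ->
  (forall i j, derivable (fun w => Xi w i j) z 1) -> mx_is_derive Y z Y' ->
  Xi z *m (Y' - X' *m (Xi z *m Y z)) = V ->
  mx_is_derive (fun w => Xi w *m Y w) z V.
Proof.
move=> XiX dX dXi dY <-.
have dV := mx_is_deriveM (mx_is_derive_mxderive dXi) dY.
set V' := _ + _ in dV.
have XV := mx_is_deriveM dX dV.
(* Near z the product X (Xi Y) is Y itself. Comparing the two derivatives gives Y' = X' Xi Y + X V',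
   which is solved for V' with no formula for the derivative of Xi. *)
have XViY i j : is_derive z 1 (fun w => (X w *m (Xi w *m Y w)) i j) (Y' i j).
  apply: near_eq_is_derive (dY i j) => //.
  by apply: filterS XiX => w /mulmx1C XXi; rewrite mulmxA XXi mul1mx.
have eY : Y' = X' *m (Xi z *m Y z) + X z *m V'.
  by rewrite -(mx_is_deriveE XV) (mx_is_deriveE XViY).
have -> : Xi z *m (Y' - X' *m (Xi z *m Y z)) = V'.
  by rewrite eY addrC addKr mulmxA (nbhs_singleton XiX) mul1mx.
exact: dV.
Qed.

End MatrixDerivative.

Section MatrixModulus.
Variable R : realType.
Notation C := (Num.NumField.sort (R[i] : numFieldType)).

Definition mnorm m n (A : 'M[C]_(m, n)) : R := \sum_i \sum_j cabs (A i j).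

Lemma mnorm_ge0 m n (A : 'M[C]_(m, n)) : 0 <= mnorm A.
Proof. by apply: sumr_ge0 => i _; apply: sumr_ge0 => j _; exact: cabs_ge0. Qed.

Lemma cabs_le_mnorm m n (A : 'M[C]_(m, n)) i j : cabs (A i j) <= mnorm A.
Proof.
rewrite /mnorm (bigD1 i) //= (bigD1 j) //= -addrA lerDl addr_ge0 //.
  by apply: sumr_ge0 => k _; exact: cabs_ge0.
by apply: sumr_ge0 => k _; apply: sumr_ge0 => l _; exact: cabs_ge0.
Qed.

Lemma mnormD m n (A B : 'M[C]_(m, n)) : mnorm (A + B) <= mnorm A + mnorm B.
Proof.
rewrite /mnorm -big_split; apply: ler_sum => i _; rewrite -big_split.
by apply: ler_sum => j _; rewrite mxE cabsD.
Qed.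

Lemma mnormN m n (A : 'M[C]_(m, n)) : mnorm (- A) = mnorm A.
Proof. by apply: eq_bigr => i _; apply: eq_bigr => j _; rewrite mxE cabsN. Qed.

Lemma mnormZ m n (c : C) (A : 'M[C]_(m, n)) : mnorm (c *: A) = cabs c * mnorm A.
Proof.
rewrite /mnorm mulr_sumr; apply: eq_bigr => i _; rewrite mulr_sumr.
by apply: eq_bigr => j _; rewrite mxE cabsM.
Qed.

Lemma mnormM m n p (A : 'M[C]_(m, n)) (B : 'M[C]_(n, p)) :
  mnorm (A *m B) <= mnorm A * mnorm B.
Proof.
have AB i k j : cabs (A i k * B k j) <= cabs (A i k) * \sum_l cabs (B k l).
  rewrite cabsM ler_wpM2l ?cabs_ge0 // (bigD1 j) //= lerDl.
  by apply: sumr_ge0 => l _; exact: cabs_ge0.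
rewrite {2}/mnorm mulr_suml; apply: ler_sum => i _; rewrite mulr_suml.
apply: (@le_trans _ _ (\sum_k cabs (A i k) * \sum_j cabs (B k j))); last first.
  apply: ler_sum => k _; rewrite ler_wpM2l ?cabs_ge0 // /mnorm.
  rewrite [leRHS](bigD1 k) //= lerDl; apply: sumr_ge0 => l _.
  by apply: sumr_ge0 => j _; exact: cabs_ge0.
under [leRHS]eq_bigr do rewrite mulr_sumr.
rewrite exchange_big /=; apply: ler_sum => j _; rewrite mxE.
by apply: le_trans (cabs_sum _ _ _) _; apply: ler_sum => k _; rewrite cabsM.
Qed.

Lemma mnorm_small_eq0 m n (A : 'M[C]_(m, n)) :
  (forall e, 0 < e -> mnorm A <= e) -> A = 0.
Proof.
move=> h; apply/matrixP => i j; rewrite mxE; apply: cabs_small_eq0 => e e0.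
exact: le_trans (cabs_le_mnorm A i j) (h e e0).
Qed.

Lemma mnorm_le_entries m n (A : 'M[C]_(m, n)) (B : R) :
  (forall i j, cabs (A i j) <= B) -> mnorm A <= (m * n)%:R * B.
Proof.
move=> AB; apply: (@le_trans _ _ (\sum_(i < m) \sum_(j < n) B)).
  by apply: ler_sum => i _; apply: ler_sum.
by rewrite !sumr_const !card_ord -mulrnA mulr_natl (mulnC m).
Qed.

Lemma mx_derive0_segment m n (F : C -> 'M[C]_(m, n)) (a b : C) :
  (forall t : R, 0 <= t <= 1 ->
     mx_is_derive F (a + t%:C%C * (b - a)) 0) -> F b = F a.
Proof.
move=> dF; apply/matrixP => i j.
apply: (@derive0_segment R (fun w => F w i j)) => t /dF/(_ i j).
by rewrite mxE.
Qed.

End MatrixModulus.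

(** The derivative of e^{-sA} Y(s) when Y' = A Y, with X for e^{-sA}. *)
Lemma mulNmx_cancel (K : pzRingType) n p (X A : 'M[K]_n) (Y : 'M[K]_(n, p)) :
  - (X *m A) *m Y + X *m (A *m Y) = 0.
Proof. by rewrite mulNmx mulmxA addNr. Qed.

(** * The matrix exponential: convergence, derivative, uniqueness *)

Section MatrixExponential.
Variables (R : realType) (n : nat).
Notation C := (Num.NumField.sort (R[i] : numFieldType)).
Implicit Types (A B : 'M[C]_n) (z s : C).

Lemma cabs_mxX_le A k i j : cabs ((A ^+ k) i j) <= mnorm A ^+ k.
Proof.
elim: k i j => [|k IH] i j.
  by rewrite !expr0 mxE; case: eqP => _; rewrite ?cabs0 ?cabs1.
rewrite !exprS mxE; apply: le_trans (cabs_sum _ _ _) _.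
apply: (@le_trans _ _ (\sum_l cabs (A i l) * mnorm A ^+ k)).
  by apply: ler_sum => l _; rewrite cabsM ler_wpM2l ?cabs_ge0.
rewrite -mulr_suml ler_wpM2r ?exprn_ge0 ?mnorm_ge0 //.
rewrite /mnorm [leRHS](bigD1 i) //= lerDl; apply: sumr_ge0 => l _.
by apply: sumr_ge0 => j' _; exact: cabs_ge0.
Qed.

Lemma exp_term_le (x : R) k : 0 <= x -> x ^+ k / k`!%:R <= expR x.
Proof.
move=> x0; case: k => [|k].
  by rewrite expr0 divr1; apply: le_trans (expR_ge1Dx x); rewrite lerDl.
by apply: le_trans (expR_ge1Dxn k x0); rewrite lerDr.
Qed.

(** One term (2M)^k / k! of the series of e^{2M} is at most its sum; the 2 supplies the geometric
    factor. *)
Lemma mxexp_coef_le A (M : R) k i j : mnorm A <= M ->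
  cabs ((k`!%:R)^-1 * (A ^+ k) i j) <= expR (2 * M) / 2 ^+ k.
Proof.
move=> AM; have M0 : 0 <= M := le_trans (mnorm_ge0 A) AM.
rewrite cabsM cabsV cabs_nat ler_pdivlMr ?exprn_gt0 //.
apply: le_trans (exp_term_le k (mulr_ge0 (ler0n _ 2) M0)).
rewrite exprMn -mulrA mulrC ler_wpM2r ?invr_ge0 // mulrC ler_wpM2l ?exprn_ge0 //.
by apply: le_trans (cabs_mxX_le A k i j) _; rewrite lerXn2r // nnegrE mnorm_ge0.
Qed.

Lemma mxexp_series A i j :
  series (fun k => (k`!%:R)^-1 * (A ^+ k) i j) @ \oo --> mxexp A i j.
Proof.
rewrite mxE; apply: (series_geometric_cvg (B := expR (2 * mnorm A))) => k.
exact: mxexp_coef_le.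
Qed.

(** The bound depends on M alone, hence is uniform for z B on a circle |z| = const. *)
Lemma mnorm_mxexp_le A (M : R) : mnorm A <= M ->
  mnorm (mxexp A) <= (n * n)%:R * (2 * expR (2 * M)).
Proof.
move=> AM; apply: mnorm_le_entries => i j.
have := series_geometric_tail 0 (fun k => mxexp_coef_le k i j AM)
  (@mxexp_series A i j).
by rewrite /series /= big_geq // subr0 expr0 divr1.
Qed.

Lemma mxX_scale z A k : (z *: A) ^+ k = z ^+ k *: A ^+ k.
Proof.
elim: k => [|k IH]; first by rewrite !expr0 scale1r.
by rewrite !exprS IH -[LHS]/((z *: A) *m (z ^+ k *: A ^+ k))
  -scalemxAl -scalemxAr scalerA.
Qed.

Lemma mxexpZ_series A z i j :
  series (fun k => z ^+ k * ((k`!%:R)^-1 * (A ^+ k) i j)) @ \oo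
    --> mxexp (z *: A) i j.
Proof.
have := @mxexp_series (z *: A) i j.
by under eq_fun do rewrite mxX_scale mxE mulrCA.
Qed.

Lemma mxexp0 : mxexp (0 : 'M[C]_n) = 1%:M.
Proof.
apply/matrixP => i j; rewrite -(scale0r 0).
rewrite (powerseries_at0 (f := fun z => mxexp (z *: 0) i j)
  (fun z => @mxexpZ_series 0 z i j)).
by rewrite fact0 invr1 mul1r expr0.
Qed.

Lemma mxexp_comm A B : A *m B = B *m A -> mxexp A *m B = B *m mxexp A.
Proof.
move=> AB; have ABk k : A ^+ k *m B = B *m A ^+ k.
  elim: k => [|k IH]; first by rewrite expr0 mul1mx mulmx1.
  by rewrite exprS -[A * _]/(A *m _) -mulmxA IH !mulmxA AB.
apply/matrixP => i j; rewrite [LHS]mxE [RHS]mxE.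
have h1 := cvg_sum_ord (fun l => @cvg_scale _ (B l j) _ _ (@mxexp_series A i l)).
have h2 := cvg_sum_ord (fun l => @cvg_scale _ (B i l) _ _ (@mxexp_series A l j)).
under eq_bigr do rewrite mulrC.
apply: (cvg_seq_unique h1); apply: cvg_trans h2; apply: near_eq_cvg.
near=> N; rewrite /series /=.
under eq_bigr do rewrite mulr_sumr; under [RHS]eq_bigr do rewrite mulr_sumr.
rewrite exchange_big [RHS]exchange_big /=; apply: eq_bigr => k _.
have := congr1 (fun M : 'M[C]_n => (k`!%:R)^-1 * M i j) (ABk k).
rewrite [in X in X -> _]mxE [in X in X -> _]mxE !mulr_sumr => e.
under [LHS]eq_bigr do rewrite mulrCA; rewrite -e.
by apply: eq_bigr => l _; rewrite mulrA mulrC.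
Unshelve. all: by end_near. Qed.

Lemma mx_is_derive_mxexp A z :
  mx_is_derive (fun w => mxexp (w *: A)) z (A *m mxexp (z *: A)).
Proof.
move=> i j; apply: (is_derive_powerseries (fun w => @mxexpZ_series A w i j)).
rewrite mxE; have h := cvg_sum_ord
  (fun l => @cvg_scale _ (A i l) _ _ (@mxexpZ_series A z l j)).
apply: cvg_trans h; apply: near_eq_cvg; near=> N; rewrite /series /=.
under eq_bigr do rewrite mulr_sumr.
rewrite exchange_big /=; apply: eq_bigr => k _.
have fk : (k.+1`!%:R)^-1 *+ k.+1 = (k`!%:R)^-1 :> C.
  by rewrite -[LHS]mulr_natl factS natrM invfM mulrA mulfV ?mul1r.
rewrite exprS -[A * _]/(A *m _) [in RHS]mxE -mulrnAl fk !mulr_sumr.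
by apply: eq_bigr => l _; rewrite mulrCA (mulrCA (A i l)).
Unshelve. all: by end_near. Qed.

Lemma mx_is_derive_mxexpr A z :
  mx_is_derive (fun w => mxexp (w *: A)) z (mxexp (z *: A) *m A).
Proof.
rewrite mxexp_comm; first exact: mx_is_derive_mxexp.
by rewrite -scalemxAl -scalemxAr.
Qed.

Lemma mx_is_derive_mxexpN A z :
  mx_is_derive (fun w => mxexp (w *: - A)) z (- (mxexp (z *: - A) *m A)).
Proof. by rewrite -mulmxN; exact: mx_is_derive_mxexpr. Qed.

Lemma mx_derive0_const p q (F : C -> 'M[C]_(p, q)) z :
  (forall s, mx_is_derive F s 0) -> F z = F 0.
Proof. by move=> dF; apply: mx_derive0_segment => t _; exact: dF. Qed.

Lemma mxexpNK A z : mxexp (z *: - A) *m mxexp (z *: A) = 1%:M.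
Proof.
rewrite (@mx_derive0_const _ _ (fun z => mxexp (z *: - A) *m mxexp (z *: A))).
  by rewrite !scale0r !mxexp0 mul1mx.
move=> s; have := mx_is_deriveM (mx_is_derive_mxexpN A s) (mx_is_derive_mxexp A s).
by rewrite mulNmx_cancel.
Qed.

(** e^{-sA} Y(s) has derivative 0, so it keeps its value at s = 0. *)
Lemma mxexp_unique A p (Y : C -> 'M[C]_(n, p)) z :
  (forall s, mx_is_derive Y s (A *m Y s)) -> Y z = mxexp (z *: A) *m Y 0.
Proof.
move=> dY.
have E : mxexp (z *: - A) *m Y z = Y 0.
  rewrite (@mx_derive0_const _ _ (fun z => mxexp (z *: - A) *m Y z)).
    by rewrite scale0r mxexp0 mul1mx.
  move=> s; have := mx_is_deriveM (mx_is_derive_mxexpN A s) (dY s).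
  by rewrite mulNmx_cancel.
by rewrite -E mulmxA (mulmx1C (mxexpNK A z)) mul1mx.
Qed.

(* [A, B] = B gives A B = B (A + 1), hence e^{zA} B = B e^{z(A+1)}.           *)
Lemma mxexp_eigen A B z : A *m B - B *m A = B ->
  mxexp (z *: A) *m B = cexp z *: (B *m mxexp (z *: A)).
Proof.
move=> AB; have AB' : B + B *m A = A *m B by rewrite -[X in X + _]AB subrK.
pose Y s := cexp s *: (B *m mxexp (s *: A)).
have dY s : mx_is_derive Y s (A *m Y s).
  have := mx_is_deriveZ (is_derive_cexp s)
    (mx_is_deriveM (mx_is_derive_cst B s) (mx_is_derive_mxexp A s)).
  rewrite mul0mx add0r -scalerDr mulmxA -mulmxDl AB'.
  by rewrite /Y -scalemxAr mulmxA.
have := mxexp_unique z dY.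
by rewrite /Y scale0r mxexp0 mulmx1 cexp0 scale1r => ->.
Qed.

End MatrixExponential.

(** * Behaviour of the fundamental solution at x = 0 *)

Section PartialIncrement.
Variable K : numFieldType.

Lemma diff_remainder (f : K * K -> K) (e : K) :
  differentiable f (0, 0) -> 0 < e -> \forall p \near (0 : K * K),
    `|f p - f (0, 0) - 'd f (0, 0) p| <= e * (`|p.1| + `|p.2|).
Proof.
move=> /diff_locally/eqaddoP df e0; apply: filterS (df e e0) => p.
have -> : ((f \o shift (0, 0)) - (cst (f (0, 0)) + 'd f (0, 0))) p =
    f p - f (0, 0) - 'd f (0, 0) p.
  by rewrite -[LHS]/(f (p + 0) - (f (0, 0) + 'd f (0, 0) p)) addr0 opprD addrA.
move=> /le_trans; apply; apply: ler_wpM2l; first exact: ltW.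
by rewrite prod_normE /Num.max; case: ifP => _; rewrite ?lerDl ?lerDr.
Qed.

(** The expansions at p and at (p.1, 0) are subtracted: the differential leaves only its part along
    the second axis, and the two remainders give [e + e]. Differentiability at the origin thus
    controls increments in the second variable at nearby points. *)
Lemma partial_increment_le (f : K * K -> K) (e : K) :
  differentiable f (0, 0) -> 0 < e -> \forall p \near (0 : K * K),
    `|f p - f (p.1, 0)| <=
      `|'d f (0, 0) (0, 1)| * `|p.2| + (e + e) * (`|p.1| + `|p.2|).
Proof.
move=> df e0; have /nbhs_ballP[d /= d0 hd] := diff_remainder df e0.
apply/nbhs_ballP; exists d => //= p pd.
have pd' : ball (0 : K * K) d (p.1, 0) by case: pd => /= p1 _; split => //=; exact: ballxx.
have h1 := hd _ pd; have := hd _ pd'; rewrite /= normr0 addr0 => h2.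
have dE : 'd f (0, 0) p = 'd f (0, 0) (p.1, 0) + p.2 * 'd f (0, 0) (0, 1).
  rewrite -[p.2 * _]/(p.2 *: _) -linearZ -linearD; congr ('d f _ _).
  case: p {pd pd' h1 h2} => a b; rewrite -[RHS]/(a + b * 0, 0 + b * 1).
  by rewrite mulr0 mulr1 addr0 add0r.
have -> : f p - f (p.1, 0) = 'd f (0, 0) (0, 1) * p.2
    + ((f p - f (0, 0) - 'd f (0, 0) p)
       - (f (p.1, 0) - f (0, 0) - 'd f (0, 0) (p.1, 0))).
  by rewrite dE; ring.
apply: le_trans (ler_normD _ _) _; rewrite normrM lerD2l.
apply: le_trans (ler_normB _ _) _; rewrite mulrDl lerD //.
by apply: le_trans h2 _; apply: ler_wpM2l; [exact: ltW | rewrite lerDl].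
Qed.

End PartialIncrement.

Section ComplexPartialIncrement.
Variable R : realType.
Notation C := (Num.NumField.sort (R[i] : numFieldType)).

Lemma partial_increment (f : C * C -> C) (e : R) :
  differentiable f (0, 0) -> 0 < e -> \forall p \near (0 : C * C),
    cabs (f p - f (p.1, 0)) <=
      cabs ('d f (0, 0) (0, 1)) * cabs p.2 + e * (cabs p.1 + cabs p.2).
Proof.
move=> df e0; have e2 : 0 < (e / 2)%:C%C :> C by rewrite ltcR divr_gt0.
apply: filterS (partial_increment_le df e2) => p.
by rewrite !cabsE -!(rmorphD, rmorphM) /= lecR -splitr.
Qed.

End ComplexPartialIncrement.

(** Each matrix product (NA for N A, DS for D S, and so on) is an independent variable, so that the
    identity becomes additive and can be checked entry by entry. *)
Lemma matching_identity (K : comNzRingType) m n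
    (N E NA EA S DS AN AE B a BD aD : 'M[K]_(m, n)) :
  N + E = - (NA + EA) + (S + DS) + (AN + AE) + (B + BD + (a + aD)) ->
  N + NA - AN - (S + B) = DS + BD + a + aD - E - EA + AE.
Proof.
move=> /matrixP h; apply/matrixP => i j; have := h i j; rewrite !mxE => /eqP.
rewrite -subr_eq0 => /eqP h0; apply/eqP; rewrite -subr_eq0 -[X in _ == X]h0.
by apply/eqP; ring.
Qed.

Section Asymptotics.
Variable R : realType.
Notation C := (Num.NumField.sort (R[i] : numFieldType)).

Lemma mnorm_linear_eq0 m n (A : 'M[C]_(m, n)) (k : R) :
  (forall e, 0 < e -> e <= 1 -> mnorm A <= e * k) -> A = 0.
Proof.
move=> h; apply: mnorm_small_eq0 => e e0.
have k1 : 0 < `|k| + 1 by rewrite ltr_wpDl.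
pose d := Num.min 1 (e / (`|k| + 1)).
have d0 : 0 < d by rewrite lt_min ltr01 divr_gt0.
have d1 : d <= 1 by rewrite ge_min lexx.
have de : d * (`|k| + 1) <= e by rewrite -ler_pdivlMr // ge_min lexx orbT.
apply: le_trans (h d d0 d1) _; have := ler_norm k; nra.
Qed.

Lemma mnorm_near (T : Type) (F : set_system T) (FF : Filter F) m n
    (A : T -> 'M[C]_(m, n)) :
  (forall i j (e : R), 0 < e -> \forall t \near F, cabs (A t i j) <= e) ->
  forall e : R, 0 < e -> \forall t \near F, mnorm (A t) <= e.
Proof.
move=> h e e0; pose c : R := (m * n)%:R; have c0 : 0 < c + 1 by rewrite ltr_wpDl.
have : \forall t \near F, forall i j, cabs (A t i j) <= e / (c + 1).
  by apply: filter_forall => i; apply: filter_forall => j; apply: h; exact: divr_gt0.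
apply: filterS => t /mnorm_le_entries/le_trans; apply; rewrite -/c.
rewrite mulrA ler_pdivrMr //; have : 0 <= c by []; nra.
Qed.

(* The term of order y must vanish first; the remaining bounded terms then
   match in the limit.                                                        *)
Lemma matching n (N A B S : 'M[C]_n) :
  (forall e : R, 0 < e -> exists2 y : R, e^-1 <= y &
     exists E a D : 'M[C]_n,
       [/\ mnorm E <= e, mnorm a <= e, mnorm D <= e &
        y%:C%C *: N + E = - ((y%:C%C *: N + E) *m A) + (1%:M + D) *m S
          + A *m (y%:C%C *: N + E) + (B + a) *m (1%:M + D)]) ->
  S = - B.
Proof.
move=> h; pose W := N + N *m A - A *m N.
(* The seven error terms, each at most e times a constant: D S, B D, then a, a D and E (the 3), then
   E A and A E. *)
pose k := mnorm S + mnorm B + 3 + 2 * mnorm A.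
have key (e : R) : 0 < e -> e <= 1 -> exists2 y : R, e^-1 <= y &
    mnorm (y%:C%C *: W - (S + B)) <= e * k.
  move=> e0 e1; have [y ye [E [a [D [Ee ae De eq]]]]] := h e e0.
  exists y => //.
  have -> : y%:C%C *: W - (S + B) =
      D *m S + B *m D + a + a *m D - E - E *m A + A *m E.
    move: eq; rewrite !mulmxDl !mulmxDr !mul1mx !mulmx1.
    rewrite -!scalemxAl -!scalemxAr => /matching_identity <-.
    by rewrite /W scalerBr scalerDr.
  have S0 := mnorm_ge0 S; have B0 := mnorm_ge0 B; have A0 := mnorm_ge0 A.
  have E0 := mnorm_ge0 E; have a0 := mnorm_ge0 a; have D0 := mnorm_ge0 D.
  have b1 : mnorm (D *m S) <= e * mnorm S.
    by apply: le_trans (mnormM _ _) _; rewrite ler_wpM2r.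
  have b2 : mnorm (B *m D) <= e * mnorm B.
    by apply: le_trans (mnormM _ _) _; rewrite mulrC ler_wpM2r.
  have b3 : mnorm (a *m D) <= e.
    by apply: le_trans (mnormM _ _) _; nra.
  have b4 : mnorm (E *m A) <= e * mnorm A.
    by apply: le_trans (mnormM _ _) _; rewrite ler_wpM2r.
  have b5 : mnorm (A *m E) <= e * mnorm A.
    by apply: le_trans (mnormM _ _) _; rewrite mulrC ler_wpM2r.
  have c1 := mnormD (D *m S + B *m D + a + a *m D - E - E *m A) (A *m E).
  have c2 := mnormD (D *m S + B *m D + a + a *m D - E) (- (E *m A)).
  have c3 := mnormD (D *m S + B *m D + a + a *m D) (- E).
  have c4 := mnormD (D *m S + B *m D + a) (a *m D).
  have c5 := mnormD (D *m S + B *m D) a.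
  have c6 := mnormD (D *m S) (B *m D).
  move: c2 c3; rewrite !mnormN /k => c2 c3; lra.
(* Here y |W| <= k + |S + B| stays bounded while 1 <= e y, so |W| is at most e times a constant. *)
have W0 : W = 0.
  apply: (@mnorm_linear_eq0 _ _ _ (k + mnorm (S + B))) => e e0 e1.
  have [y ye hy] := key e e0 e1.
  have y0 : 0 < y by apply: lt_le_trans ye; rewrite invr_gt0.
  have yW : y * mnorm W <= e * k + mnorm (S + B).
    rewrite -(gtr0_norm y0) -cabs_real -mnormZ.
    rewrite -(subrK (S + B) (_ *: W)); apply: le_trans (mnormD _ _) _.
    by rewrite lerD2r.
  have ye1 : 1 <= e * y by rewrite mulrC -ler_pdivrMr // div1r.
  have := mnorm_ge0 W; have := mnorm_ge0 (S + B); have := mnorm_ge0 S.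
  have := mnorm_ge0 B; have := mnorm_ge0 A; move=> A0 B0 S0 SB0 W0.
  have k0 : 0 <= k by rewrite /k; lra.
  have : mnorm W <= e * (y * mnorm W) by rewrite mulrA ler_peMl.
  move/le_trans; apply; apply: ler_wpM2l; first exact: ltW.
  by apply: le_trans yW _; rewrite lerD2r ler_piMl.
suff : S + B = 0 by move/eqP; rewrite addr_eq0 => /eqP.
apply: (@mnorm_linear_eq0 _ _ _ k) => e e0 e1.
have [y _] := key e e0 e1; by rewrite W0 scaler0 sub0r mnormN.
Qed.

End Asymptotics.

(** * Limits at x = 0 along L = - y, y real tending to + oo *)

Section NearOrigin.
Variables (R : realType) (mu : nat).
Notation C := (Num.NumField.sort (R[i] : numFieldType)).

Lemma cabs_cexp_real (y : R) : cabs (cexp (- y)%:C%C) = expR (- y).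
Proof. by rewrite cabs_cexp. Qed.

Lemma expRN_le (y : R) : 0 < y -> expR (- y) <= 2 / y ^+ 2.
Proof.
move=> y0; rewrite expRN -[leRHS]invrK lef_pV2 ?posrE ?expR_gt0 //.
  by rewrite invf_div; apply: le_trans (exp_term_le 2 (ltW y0)); rewrite lexx.
by rewrite invr_gt0 divr_gt0 // exprn_gt0.
Qed.

Lemma expRN_small (d : R) : 0 < d -> \forall y \near +oo, expR (- y) < d.
Proof.
move=> d0; near=> y; have y0 : 0 < y by near: y; apply: nbhs_pinfty_gt; exact: num_real.
have yd : d^-1 < y by near: y; apply: nbhs_pinfty_gt; exact: num_real.
rewrite expRN -[ltRHS]invrK ltf_pV2 ?posrE ?expR_gt0 ?invr_gt0 //.
by apply: lt_le_trans yd _; apply: le_trans (expR_ge1Dx y); rewrite lerDr.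
Unshelve. all: by end_near. Qed.

Lemma near_cexp (S : C -> Prop) : (\forall x \near 0, S x) ->
  \forall y \near +oo, S (cexp (- y)%:C%C).
Proof.
move=> /near0CP[d d0 hS]; apply: filterS (expRN_small d0) => y yd.
by apply: hS; rewrite cabs_cexp_real.
Qed.

(** Uniform in tau over the disc of radius 1/y: Cauchy's estimate is applied on a circle that
    shrinks with y. *)
Lemma near_cexp2 (S : C * C -> Prop) : (\forall p \near (0 : C * C), S p) ->
  \forall y \near +oo, forall tau : C, cabs tau <= y^-1 ->
    S (tau, cexp (- y)%:C%C).
Proof.
move=> /nbhs_ballP[d /= d0 hS].
have dE : d = (complex.Re d)%:C%C by rewrite RRe_real // gtr0_real.
have d0' : 0 < complex.Re d by rewrite -ltcR -dE.
near=> y => tau tauy.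
have y0 : 0 < y by near: y; apply: nbhs_pinfty_gt; exact: num_real.
have yd : (complex.Re d)^-1 < y by near: y; apply: nbhs_pinfty_gt; exact: num_real.
apply: hS; split; rewrite -ball_normE /= sub0r normrN cabsE dE ltcR.
  apply: le_lt_trans tauy _.
  by rewrite -[ltRHS]invrK ltf_pV2 ?posrE ?invr_gt0.
by rewrite cabs_cexp_real; near: y; exact: expRN_small.
Unshelve. all: by end_near. Qed.

Lemma near_logdisc (r : \bar R) : (0 < r)%E ->
  \forall y \near +oo, logdisc r (- y)%:C%C.
Proof.
case: r => [r||//] r0.
  apply: filterS (expRN_small (_ : 0 < r)) => [y yr|]; last by rewrite -lte_fin.
  change ((cabs (cexp (- y)%:C%C))%:E < r%:E)%E.
  by rewrite cabs_cexp_real lte_fin.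
by near=> y; rewrite /logdisc /disc /= ltry.
Unshelve. all: by end_near. Qed.

Lemma near_holomorphic1 (F : C -> 'M[C]_mu) : holomorphic1 setT F ->
  forall e : R, 0 < e ->
  \forall y \near +oo, mnorm (F (cexp (- y)%:C%C) - F 0) <= e.
Proof.
move=> dF; apply: mnorm_near => i j e e0.
apply: (near_cexp (S := fun x => cabs ((F x - F 0) i j) <= e)).
have /derivable1_diffP/differentiable_continuous/cvgCP/(_ e e0) := dF i j 0 I.
by apply: filterS => x; rewrite !mxE cabsBC => /ltW.
Qed.

End NearOrigin.

Section CanonicalAsymptotics.
Variables (R : realType) (mu : nat).
Notation C := (Num.NumField.sort (R[i] : numFieldType)).
Variables (Q : logConnection (R[i] : numFieldType) mu) (r : \bar R).
Variables H P : C -> C -> 'M[C]_mu.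
Hypothesis r_gt0 : (0 < r)%E.
Hypothesis H_holo :
  holomorphic2 [set p : C * C | disc r p.2] (fun p => H p.1 p.2).
Hypothesis H_at0 : forall tau : C, H tau 0 = 1%:M.
Hypothesis P_def : forall tau L : C,
  P tau L = H tau (cexp L) *m mxexp (- ((tau * L) *: M1 Q 0)).
Hypothesis P_fund : fundamental_solution Q r P.

(** As H(tau, 0) = I, this is the increment of H in x. For |tau| = 1/y the bound is of order M
    e^{-y} + 2 e / y; after division by the radius 1/y in Cauchy's estimate it still becomes
    arbitrarily small. *)
Lemma H_increment (e : R) : 0 < e -> exists2 M : R, 0 <= M &
  \forall y \near +oo, forall tau : C, cabs tau <= y^-1 ->
    mnorm (H tau (cexp (- y)%:C%C) - 1%:M) <=
      M * expR (- y) + e * (cabs tau + expR (- y)).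
Proof.
move=> e0; pose f i j (p : C * C) := H p.1 p.2 i j.
have df i j : differentiable (f i j) (0, 0).
  by apply: H_holo; change ((cabs (0 : C))%:E < r)%E; rewrite cabs0.
pose c : R := (mu * mu)%:R; have c1 : 0 < c + 1 by rewrite ltr_wpDl.
pose M : R := \sum_i \sum_j cabs ('d (f i j) (0, 0) (0, 1)).
exists M.
  by apply: sumr_ge0 => i _; apply: sumr_ge0 => j _; exact: cabs_ge0.
have near_ij : \forall p \near (0 : C * C), forall i j,
    cabs (f i j p - f i j (p.1, 0)) <=
      cabs ('d (f i j) (0, 0) (0, 1)) * cabs p.2
      + e / (c + 1) * (cabs p.1 + cabs p.2).
  apply: (@filter_forall _ _ _ _ (nbhs_filter (0 : C * C))) => i.
  apply: (@filter_forall _ _ _ _ (nbhs_filter (0 : C * C))) => j.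
  by apply: partial_increment => //; exact: divr_gt0.
apply: filterS (near_cexp2 near_ij) => y hy tau tauy.
have h := hy tau tauy; rewrite /= cabs_cexp_real in h.
set s := cabs tau + _ in h *.
have s0 : 0 <= s by rewrite addr_ge0 ?cabs_ge0 ?expR_ge0.
apply: (@le_trans _ _ (\sum_i \sum_j
    (cabs ('d (f i j) (0, 0) (0, 1)) * expR (- y) + e / (c + 1) * s))).
  apply: ler_sum => i _; apply: ler_sum => j _; apply: le_trans (h i j).
  by rewrite /f /= !mxE H_at0 mxE.
under eq_bigr do rewrite big_split /=; rewrite big_split /=; apply: lerD.
  by rewrite /M mulr_suml; apply: ler_sum => i _; rewrite mulr_suml.
rewrite !sumr_const !card_ord -mulrnA -mulr_natl -/c.
have -> : c * (e / (c + 1) * s) = (c / (c + 1)) * (e * s).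
  by field; exact: lt0r_neq0.
rewrite ler_piMl ?mulr_ge0 ?(ltW e0) //.
by rewrite ler_pdivrMr // mul1r lerDl.
Qed.

Lemma near_P0 (e : R) : 0 < e ->
  \forall y \near +oo, mnorm (P 0 (- y)%:C%C - 1%:M) <= e.
Proof.
move=> e0; have [M M0 hM] := H_increment ltr01.
have M1 : 0 < M + 1 by rewrite ltr_wpDl.
near=> y; rewrite P_def mul0r scale0r oppr0 mxexp0 mulmx1.
have y0 : 0 < y by near: y; apply: nbhs_pinfty_gt; exact: num_real.
have h : forall tau : C, cabs tau <= y^-1 ->
    mnorm (H tau (cexp (- y)%:C%C) - 1%:M) <=
      M * expR (- y) + 1 * (cabs tau + expR (- y)) by near: y.
have := h 0; rewrite cabs0 invr_ge0 (ltW y0) => /(_ isT) /le_trans; apply.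
have : expR (- y) < e / (M + 1) by near: y; apply: expRN_small; exact: divr_gt0.
by rewrite ltr_pdivlMr // add0r mul1r => he; lra.
Unshelve. all: by end_near. Qed.

Lemma fundamental_derive0 Pc L i j :
  (forall tau, mxseries_cvg (fun k => tau ^+ k *: Pc k) (P tau L)) ->
  is_derive (0 : C) 1 (fun tau => P tau L i j) (Pc 1%N i j).
Proof.
move=> hP; apply: (@is_derive_powerseries _ (fun k => Pc k i j)).
  by move=> w; have := hP w i j; under eq_fun do rewrite mxE.
have := @series_at0 R (fun k => Pc k.+1 i j *+ k.+1).
by rewrite mulr1n.
Qed.

(* In the coefficient of tau of P(tau, L) - e^{-tau L M1(0)}, Cauchy's estimate
   on the circle |tau| = 1/|L| keeps the exponential bounded and needs no more
   about H than its differentiability at (0, 0).                              *)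
Lemma near_P1 (e : R) : 0 < e -> \forall y \near +oo,
  mnorm (mxderive (fun tau => P tau (- y)%:C%C) 0 - y%:C%C *: M1 Q 0) <= e.
Proof.
have [[Pc _ hPc] _ _ _] := P_fund.
apply: (@mnorm_near R _ (pinfty_nbhs R)) => {e} i j e e0.
(* On the circle |z| = 1/y the norm of z y M1(0) is that of M1(0), so b bounds the exponential there
   for every y. *)
pose N := M1 Q 0; pose b : R := (mu * mu)%:R * (2 * expR (2 * mnorm N)).
have b0 : 0 <= b by rewrite !mulr_ge0 // expR_ge0.
have b1 : 0 < b + 1 by rewrite ltr_wpDl.
(* The final bound is 2 M b / y + 2 d b; this d keeps the second term below e / 2. *)
pose d : R := e / (4 * (b + 1)).
have d0 : 0 < d by rewrite divr_gt0 // mulr_gt0.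
have [M M0 hM] := H_increment d0.
near=> y.
(* y > 2 gives e^{-y} <= 2 / y^2 <= 1 / y, and the next bound makes 2 M b / y <= e / 2. *)
have y2 : 2 < y by near: y; apply: nbhs_pinfty_gt; exact: num_real.
have yM : 4 * (M * b) / e < y by near: y; apply: nbhs_pinfty_gt; exact: num_real.
have y0 : 0 < y by apply: lt_trans y2.
have Hy : forall tau : C, cabs tau <= y^-1 ->
    mnorm (H tau (cexp (- y)%:C%C) - 1%:M) <=
      M * expR (- y) + d * (cabs tau + expR (- y)) by near: y.
have Ly : logdisc r (- y)%:C%C by near: y; exact: near_logdisc.
set L : C := (- y)%:C%C in Hy Ly *.
pose B := y%:C%C *: N.
have PE tau : P tau L = H tau (cexp L) *m mxexp (tau *: B).
  rewrite P_def; congr (_ *m mxexp _).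
  by rewrite /B scalerA -scaleNr -mulrN /L rmorphN opprK.
(* The coefficients of p(z), an entry of (H - I) e^{zB}; the one of degree 1 is the entry to be
   estimated. *)
pose c k := Pc k L i j - (k`!%:R)^-1 * (B ^+ k) i j.
pose p tau := P tau L i j - mxexp (tau *: B) i j.
have cp z : series (fun k => z ^+ k * c k) @ \oo --> p z.
  have h1 := hPc z L Ly i j; have h2 := @mxexpZ_series R mu B z i j.
  apply: cvg_trans (cvg_sub h1 h2); apply: near_eq_cvg; near=> n.
  rewrite /series /= -sumrB; apply: eq_bigr => k _.
  by rewrite mxE /c mulrBr.
have e2y : expR (- y) <= 2 / y ^+ 2 := expRN_le y0.
have ey : expR (- y) <= y^-1.
  apply: le_trans e2y _; rewrite expr2 invfM mulrA ler_piMl ?invr_ge0 ?(ltW y0) //.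
  by rewrite ler_pdivrMr // mul1r ltW.
have pB z : cabs z = y^-1 -> cabs (p z) <= (M * (2 / y ^+ 2) + d * (2 / y)) * b.
  move=> zy; have -> : p z = ((H z (cexp L) - 1%:M) *m mxexp (z *: B)) i j.
    by rewrite mulmxBl mul1mx -PE [RHS]mxE [in RHS]mxE.
  apply: le_trans (cabs_le_mnorm _ _ _) _; apply: le_trans (mnormM _ _) _.
  apply: ler_pM; rewrite ?mnorm_ge0 //; last first.
    apply: mnorm_mxexp_le; rewrite /B scalerA mnormZ cabsM zy cabs_real gtr0_norm //.
    by rewrite mulVf ?mul1r // lt0r_neq0.
  have zy' : cabs z <= y^-1 by rewrite zy.
  apply: le_trans (Hy z zy') _; rewrite zy; apply: lerD.
    exact: ler_wpM2l.
  by apply: ler_wpM2l; [exact: ltW | lra].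
have iy0 : 0 < y^-1 by rewrite invr_gt0.
have := cauchy_coef1 cp iy0 pB.
have -> : c 1%N = (mxderive (fun tau => P tau L) 0 - y%:C%C *: M1 Q 0) i j.
  rewrite mxE mxE derive1E.
  rewrite (@derive_val _ _ _ _ _ _ _ (fundamental_derive0 i j (fun tau => hPc tau L Ly))).
  by rewrite /c (_ : 1`! = 1%N) // invr1 mul1r expr1 [in RHS]mxE.
move=> /le_trans; apply.
have -> : (M * (2 / y ^+ 2) + d * (2 / y)) * b / y^-1 =
    2 * (M * b) / y + 2 * d * b by field; exact: lt0r_neq0.
have h1 : 2 * (M * b) / y <= e / 2.
  rewrite ler_pdivrMr // mulrAC ler_pdivlMr //.
  by move: yM; rewrite ltr_pdivrMr // => yM; lra.
have h2 : 2 * d * b <= e / 2.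
  have -> : 2 * d * b = (b / (b + 1)) * (e / 2).
    by rewrite /d; field; exact: lt0r_neq0.
  by rewrite ler_piMl ?divr_ge0 ?(ltW e0) // ler_pdivrMr // mul1r lerDl.
lra.
Unshelve. all: by end_near. Qed.

End CanonicalAsymptotics.

(** * Identification of the transformed connection with the classical one *)

Section ResidueIdentification.
Variables (R : realType) (mu : nat).
Notation C := (Num.NumField.sort (R[i] : numFieldType)).
Variables (Q : logConnection (R[i] : numFieldType) mu) (r : \bar R).
Variables H P : C -> C -> 'M[C]_mu.
Hypothesis r_gt0 : (0 < r)%E.
Hypothesis H_holo :
  holomorphic2 [set p : C * C | disc r p.2] (fun p => H p.1 p.2).
Hypothesis H_at0 : forall tau : C, H tau 0 = 1%:M.
Hypothesis P_def : forall tau L : C,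
  P tau L = H tau (cexp L) *m mxexp (- ((tau * L) *: M1 Q 0)).
Hypothesis P_fund : fundamental_solution Q r P.
Hypothesis A0_holo : holomorphic1 setT (A0 Q).

Variables S0 S1 : 'M[C]_mu.
Hypothesis P_conf : forall tau L : C, tau != 0 -> logdisc r L ->
  omega_tau Q tau (cexp L) *m P tau L
    + tau *: mxderive (fun t => P t L) tau = P tau L *m (S0 + tau *: S1).

Lemma P_derive_tau (L tau : C) : logdisc r L ->
  mx_is_derive (fun t => P t L) tau (mxderive (fun t => P t L) tau).
Proof.
move=> rL; have [_ dP _ _] := P_fund; apply: mx_is_derive_mxderive.
exact: (@holomorphic2_slice2 _ _ _ _ (fun p => P p.1 p.2) tau L dP rL).
Qed.

Lemma mx_is_derive_affine (A B : 'M[C]_mu) (z : C) :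
  mx_is_derive (fun w => A + w *: B) z B.
Proof.
have := mx_is_deriveD (mx_is_derive_cst A z)
  (mx_is_deriveZ (is_derive_id z 1) (mx_is_derive_cst B z)).
by rewrite add0r scaler0 addr0 scale1r.
Qed.

(** The conformal equation reads z P'(z) = Phi(z) for z <> 0. Entry by entry,
    [regular_singular_point] extends it to 0 in the form Phi(0) = 0 and Phi'(0) = P'(0). *)
Lemma first_order_equations (L : C) : logdisc r L ->
  let D := mxderive (fun t => P t L) 0 in
  P 0 L *m S0 + Ainf Q *m P 0 L = 0 /\
  D = D *m S0 + P 0 L *m S1 + (A0 Q (cexp L) *m P 0 L + Ainf Q *m D).
Proof.
move=> rL D.
pose Phi (z : C) := P z L *m (S0 + z *: S1)
  + (Ainf Q + z *: A0 Q (cexp L)) *m P z L.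
have dPhi := mx_is_deriveD
  (mx_is_deriveM (P_derive_tau 0 rL) (mx_is_derive_affine S0 S1 0))
  (mx_is_deriveM (mx_is_derive_affine (Ainf Q) (A0 Q (cexp L)) 0)
    (P_derive_tau 0 rL)).
rewrite !scale0r !addr0 -/D in dPhi.
set l := _ + _ in dPhi.
have key i j : Phi 0 i j = 0 /\ l i j = D i j.
  apply: (@regular_singular_point R (fun z => P z L i j)
    (fun z => mxderive (fun t => P t L) z i j) (fun z => Phi z i j)) => [z|z|].
  - exact: P_derive_tau.
  - move=> z0; have := P_conf z0 rL.
    move=> /(canRL (addKr _)); rewrite /omega_tau mulNmx opprK addrC.
    by move=> /(congr1 (fun M : 'M[C]_mu => M i j)); rewrite mxE.
  - exact: (dPhi i j).
split; apply/matrixP => i j; have [k1 k2] := key i j; last by rewrite -k2.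
by move: k1; rewrite /Phi !scale0r !addr0 => ->; rewrite mxE.
Qed.

Lemma residue0 : S0 = - Ainf Q.
Proof.
apply/eqP; rewrite -addr_eq0; apply/eqP.
apply: (@mnorm_linear_eq0 _ _ _ _ (mnorm S0 + mnorm (Ainf Q))) => e e0 _.
near (@pinfty_nbhs R) => y.
have rL : logdisc r (- y)%:C%C by near: y; exact: near_logdisc.
have hP : mnorm (P 0 (- y)%:C%C - 1%:M) <= e.
  by near: y; exact: (near_P0 r_gt0 H_holo H_at0 P_def e0).
have [+ _] := first_order_equations rL; move: hP; set D := P 0 _ - _ => hP.
(* With P(0, L) = I + D the degree 0 equation is S0 + Ainf = - (D S0 + Ainf D), of norm at most e
   (|S0| + |Ainf|). *)
have -> : P 0 (- y)%:C%C = 1%:M + D by rewrite addrC subrK.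
rewrite mulmxDl mulmxDr mul1mx mulmx1 addrACA => /eqP.
rewrite addr_eq0 => /eqP ->; rewrite mnormN; apply: le_trans (mnormD _ _) _.
rewrite mulrDr lerD //; apply: le_trans (mnormM _ _) _.
  by rewrite ler_wpM2r // mnorm_ge0.
by rewrite mulrC ler_wpM2r // mnorm_ge0.
Unshelve. all: by end_near. Qed.

Lemma residue1 : S1 = - A0 Q 0.
Proof.
apply: (@matching _ _ (M1 Q 0) (Ainf Q)) => e e0.
near (@pinfty_nbhs R) => y.
have rL : logdisc r (- y)%:C%C by near: y; exact: near_logdisc.
exists y.
  by near: y; apply: nbhs_pinfty_ge; exact: num_real.
(* The witnesses are the deviations of dP/dtau(0, L), A0(x) and P(0, L) from y M1(0), A0(0) and
   I. *)
exists (mxderive (fun t => P t (- y)%:C%C) 0 - y%:C%C *: M1 Q 0),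
  (A0 Q (cexp (- y)%:C%C) - A0 Q 0), (P 0 (- y)%:C%C - 1%:M); split.
- by near: y; exact: (near_P1 r_gt0 H_holo H_at0 P_def P_fund e0).
- by near: y; exact: near_holomorphic1.
- by near: y; exact: (near_P0 r_gt0 H_holo H_at0 P_def e0).
have [_] := first_order_equations rL; rewrite residue0.
set D := mxderive _ _; set P0 := P 0 _; set x := cexp _ => E.
rewrite (addrC _ (D - _)) (addrC 1%:M) (addrC (A0 Q 0)) !subrK {1}E.
by rewrite mulmxN (addrC (_ *m P0)) addrA.
Unshelve. all: by end_near. Qed.

End ResidueIdentification.

(** * Flat sections *)

Section NearDifferentiable.
Variable K : numFieldType.

(** Sections are extended by zero off [logdisc r]; near a point of this open set they may be
    replaced by their formula. *)
Lemma near_eq_differentiable (V W : normedModType K) (f g : V -> W) (x : V) :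
  (\near x, f x = g x) -> differentiable f x -> differentiable g x.
Proof.
move=> fg df; have [cf _] := (diff_locallyP _ _).1 df.
have eg : g \o shift x = cst (g x) + 'd f x +o_ (0 : V) id.
  apply/eqaddoP => e e0.
  have /eqaddoP/(_ e e0) := diff_locally df.
  have fg0 : \forall h \near (0 : V), f (h + x) = g (h + x).
    by move: (fg); rewrite (near_shift 0) subr0.
  apply: filterS2 fg0 => h fgh.
  rewrite -[(f \o _ - _) h]/(f (h + x) - (f x + 'd f x h)).
  rewrite -[(g \o _ - _) h]/(g (h + x) - (g x + 'd f x h)).
  by rewrite fgh (nbhs_singleton fg).
apply/diff_locallyP; rewrite (diff_unique cf eg); split=> //.
Qed.

Lemma differentiable_fst (p : K * K) : differentiable (fst : K * K -> K) p.
Proof. by apply: (@linear_differentiable _ _ _ fst) => q; exact: cvg_fst. Qed.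

Lemma differentiable_snd (p : K * K) : differentiable (snd : K * K -> K) p.
Proof. by apply: (@linear_differentiable _ _ _ snd) => q; exact: cvg_snd. Qed.

Lemma holomorphic2_mulmx m n p (D : set (K * K)) (F : K * K -> 'M[K]_(m, n))
    (G : K * K -> 'M[K]_(n, p)) :
  holomorphic2 D F -> holomorphic2 D G -> holomorphic2 D (fun z => F z *m G z).
Proof.
move=> dF dG i j z Dz.
have -> : (fun q => (F q *m G q) i j) =
    \sum_(k < n) ((fun q => F q i k) * (fun q => G q k j)).
  by apply/funext => q; rewrite mxE fct_sumE.
by apply: differentiable_sum => k; apply: differentiableM; [exact: dF | exact: dG].
Qed.

End NearDifferentiable.

Section GaugeIdentities.
Variable K : numFieldType.

(** The value required by [variation_of_constants] when X' = X W - O X and Y' = - O Y: the gauge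
    transform Xi Y solves the system of matrix W. [gauge_constant] is the case W = 0. *)
Lemma gauge_transport n p (Xi X W O : 'M[K]_n) (Y : 'M[K]_(n, p)) :
  Xi *m X = 1%:M ->
  Xi *m (- (O *m Y) - (X *m W - O *m X) *m (Xi *m Y)) = - (W *m (Xi *m Y)).
Proof.
move=> XiX; have XXi := mulmx1C XiX.
have OX : O *m X *m (Xi *m Y) = O *m Y.
  by rewrite -mulmxA (mulmxA X) XXi mul1mx.
by rewrite mulmxBl OX opprB addKr mulmxN !mulmxA XiX mul1mx.
Qed.

Lemma gauge_constant n p (Xi X O : 'M[K]_n) (Y : 'M[K]_(n, p)) :
  Xi *m X = 1%:M ->
  Xi *m (- (O *m Y) - - (O *m X) *m (Xi *m Y)) = 0.
Proof.
move=> /mulmx1C XXi; rewrite mulNmx opprK -mulmxA (mulmxA X) XXi mul1mx.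
by rewrite addNr mulmx0.
Qed.

Lemma flat_mulmxr n p (X O : 'M[K]_n) (c : 'M[K]_(n, p)) :
  - (O *m X) *m c + X *m 0 = - (O *m (X *m c)).
Proof. by rewrite mulmx0 addr0 mulNmx mulmxA. Qed.

Lemma gauge_flat n p (X W O : 'M[K]_n) (V : 'M[K]_(n, p)) :
  (X *m W - O *m X) *m V + X *m - (W *m V) + O *m (X *m V) = 0.
Proof. by rewrite mulmxBl mulmxN !mulmxA addrAC subrK subrr. Qed.

End GaugeIdentities.

Lemma base_change_eq (K : numFieldType) n (P W dP S : 'M[K]_n) :
  P \in unitmx -> base_change P W dP = S -> W *m P + dP = P *m S.
Proof.
by move=> Pu <-; rewrite /base_change mulmxDr !mulmxA mulmxV // !mul1mx.
Qed.

Lemma product_derivative (K : comNzRingType) n (A B E F : 'M[K]_n) (c : K) :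
  E *m B = c *: (B *m E) ->
  A *m E *m F + E *m (- B *m F) = - (- (A + - c *: B) *m (E *m F)).
Proof.
move=> EB; rewrite (mulNmx (A + _)) opprK mulmxDl mulNmx mulmxN (mulmxA E) EB.
by rewrite -!scalemxAl !mulmxA scaleNr.
Qed.

Section LogDisc.
Variable R : realType.
Notation C := (Num.NumField.sort (R[i] : numFieldType)).

Lemma logdiscE (r : \bar R) (L : C) :
  logdisc r L <-> ((expR (complex.Re L))%:E < r)%E.
Proof. by rewrite -cabs_cexp. Qed.

(** [logdisc r] is the half-plane Re L < ln r (all of C for r = +oo), hence convex: segments can
    serve as paths. *)
Lemma logdisc_segment (r : \bar R) (a b : C) (t : R) : 0 <= t <= 1 ->
  logdisc r a -> logdisc r b -> logdisc r (a + t%:C%C * (b - a)).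
Proof.
move=> /andP[t0 t1] /logdiscE ra /logdiscE rb; apply/logdiscE.
have -> : complex.Re (a + t%:C%C * (b - a)) =
    complex.Re a + t * (complex.Re b - complex.Re a).
  by case: a b {ra rb} => [a1 a2] [b1 b2] /=; ring.
have [ab|ba] := leP (complex.Re a) (complex.Re b).
  by apply: le_lt_trans rb; rewrite lee_fin ler_expR; nra.
by apply: le_lt_trans ra; rewrite lee_fin ler_expR; nra.
Qed.

Lemma logdisc_near (r : \bar R) (L : C) : logdisc r L ->
  \forall w \near L, logdisc r w.
Proof.
case: r => [r|_|]; last by rewrite /logdisc /disc /= ltNge leNye.
- move=> /logdiscE; rewrite lte_fin -cabs_cexp -subr_gt0 => d0.
  have := ex_derive (is_derive := is_derive_cexp L).
  move=> /derivable1_diffP/differentiable_continuous/cvgCP/(_ _ d0).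
  apply: filterS => w wL; apply/logdiscE; rewrite lte_fin -cabs_cexp.
  have := cabsDB (cexp w) 0 (cexp L); rewrite !subr0 cabsBC.
  by move: wL => /=; lra.
- by near=> w; rewrite /logdisc /disc /= ltry.
Unshelve. all: by end_near. Qed.

End LogDisc.

(** * Gauge transformation of flat sections by P and its inverse *)

Section FlatSectionMaps.
Variables (R : realType) (mu : nat).
Notation C := (Num.NumField.sort (R[i] : numFieldType)).
Variables (Q : logConnection (R[i] : numFieldType) mu) (r : \bar R).
Variables P Pi : C -> C -> 'M[C]_mu.
Hypothesis P_holo :
  holomorphic2 [set p : C * C | logdisc r p.2] (fun p => P p.1 p.2).
Hypothesis Pi_holo :
  holomorphic2 [set p : C * C | logdisc r p.2] (fun p => Pi p.1 p.2).
Hypothesis PiP : forall tau L : C, logdisc r L -> Pi tau L *m P tau L = 1%:M.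
Hypothesis P_x : forall tau L : C, logdisc r L ->
  mxderive (P tau) L + omega_x Q tau (cexp L) *m P tau L = 0.
Hypothesis P_tau : forall tau L : C, tau != 0 -> logdisc r L ->
  omega_tau Q tau (cexp L) *m P tau L
    + tau *: mxderive (fun t => P t L) tau = P tau L *m omega_tau Q tau 0.

Lemma is_derive_Ncexp (s : C) :
  is_derive s 1 (fun w => - cexp w : C) (- cexp s : C).
Proof. exact: (is_deriveN (is_derive_cexp s)). Qed.

Lemma Ncexp_neq0 (s : C) : - cexp s != 0 :> C.
Proof. by rewrite oppr_eq0 cexp_neq0. Qed.

(** For tau = - e^s the derivation d/ds is tau d/dtau, so this is [P_tau] in the variable s. *)
Lemma P_s (s L : C) : logdisc r L ->
  mx_is_derive (fun w => P (- cexp w) L) s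
    (P (- cexp s) L *m omega_tau Q (- cexp s) 0
     - omega_tau Q (- cexp s) (cexp L) *m P (- cexp s) L).
Proof.
move=> rL; rewrite -(P_tau (Ncexp_neq0 s) rL) addrC addKr.
apply: (@mx_is_derive_compose _ _ _ (fun t => P t L) (fun w => - cexp w : C)).
  apply: mx_is_derive_mxderive.
  exact: (@holomorphic2_slice2 _ _ _ _ (fun p => P p.1 p.2) _ L P_holo rL).
exact: is_derive_Ncexp.
Qed.

Lemma P_L (tau L : C) : logdisc r L ->
  mx_is_derive (P tau) L (- (omega_x Q tau (cexp L) *m P tau L)).
Proof.
move=> rL; have /eqP := P_x tau rL; rewrite addr_eq0 => /eqP <-.
apply: mx_is_derive_mxderive.
exact: (@holomorphic2_slice1 _ _ _ _ (fun p => P p.1 p.2) tau L P_holo rL).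
Qed.

Lemma Pi_s (s L : C) : logdisc r L ->
  forall i j, derivable (fun w : C => Pi (- cexp w) L i j) s 1.
Proof.
move=> rL; apply: mx_is_derive_derivable.
apply: (@mx_is_derive_compose _ _ _ (fun t => Pi t L) (fun w => - cexp w : C)).
  apply: mx_is_derive_mxderive.
  exact: (@holomorphic2_slice2 _ _ _ _ (fun p => Pi p.1 p.2) _ L Pi_holo rL).
exact: is_derive_Ncexp.
Qed.

Lemma flat_section_derive (Psi : C * C -> 'cV[C]_mu) (s L : C) :
  flat_section Q r Psi -> logdisc r L ->
  mx_is_derive (fun l => Psi (s, l)) L
    (- (omega_x Q (- cexp s) (cexp L) *m Psi (s, L))) /\
  mx_is_derive (fun t => Psi (t, L)) s
    (- (omega_tau Q (- cexp s) (cexp L) *m Psi (s, L))).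
Proof.
move=> [_ dPsi dx ds] rL; split.
  have /eqP := dx s L rL; rewrite addr_eq0 => /eqP <-.
  apply: mx_is_derive_mxderive; exact: (holomorphic2_slice1 dPsi).
have /eqP := ds s L rL; rewrite addr_eq0 => /eqP <-.
apply: mx_is_derive_mxderive; exact: (holomorphic2_slice2 dPsi).
Qed.

Lemma flat_section_clE (V : C -> 'cV[C]_mu) :
  (forall s, mx_is_derive V s (- (omega_tau Q (- cexp s) 0 *m V s))) <->
  flat_section_cl Q V.
Proof.
split=> [dV|[hV eV] s].
  split=> [i j s _|s]; first exact: (mx_is_derive_derivable (dV s)).
  by rewrite (mx_is_deriveE (dV s)) addNr.
have /eqP := eV s; rewrite addr_eq0 => /eqP <-.
by apply: mx_is_derive_mxderive => i j; exact: hV.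
Qed.

(** With L frozen the product depends on s alone; that the choice of L does not matter is the
    content of [flat_section_transport]. *)
Lemma flat_section_to_cl (Psi : C * C -> 'cV[C]_mu) (L : C) :
  flat_section Q r Psi -> logdisc r L ->
  flat_section_cl Q (fun s => Pi (- cexp s) L *m Psi (s, L)).
Proof.
move=> fPsi rL; apply/flat_section_clE => s.
have [_ dPsi] := flat_section_derive s fPsi rL.
have near_inv : \forall w \near s, Pi (- cexp w) L *m P (- cexp w) L = 1%:M.
  by apply: (@filterE _ _ (nbhs_filter (s : C))) => w; exact: PiP.
apply: (variation_of_constants near_inv (P_s s rL) (@Pi_s s L rL) dPsi).
exact: gauge_transport (PiP _ rL).
Qed.

(** Pi Psi has derivative 0 in L, both P and Psi being flat in that direction, and L0 is joined to L
    by a segment inside [logdisc r]. *)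
Lemma flat_section_transport (Psi : C * C -> 'cV[C]_mu) (s L0 L : C) :
  flat_section Q r Psi -> logdisc r L0 -> logdisc r L ->
  Psi (s, L) = P (- cexp s) L *m (Pi (- cexp s) L0 *m Psi (s, L0)).
Proof.
move=> fPsi rL0 rL.
suff <- : Pi (- cexp s) L *m Psi (s, L) = Pi (- cexp s) L0 *m Psi (s, L0).
  by rewrite mulmxA (mulmx1C (PiP _ rL)) mul1mx.
apply: (@mx_derive0_segment R _ _ (fun l => Pi (- cexp s) l *m Psi (s, l))).
move=> t t01; have := logdisc_segment t01 rL0 rL; move: (_ + _ * _) => l rl.
have [dPsi _] := flat_section_derive s fPsi rl.
have dPi : forall i j, derivable (fun w => Pi (- cexp s) w i j) l 1.
  exact: (@holomorphic2_slice1 _ _ _ _ (fun p => Pi p.1 p.2) _ l Pi_holo rl).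
have near_inv : \forall w \near l, Pi (- cexp s) w *m P (- cexp s) w = 1%:M.
  by apply: filterS (logdisc_near rl) => w; exact: PiP.
apply: (variation_of_constants near_inv (P_L (- cexp s) rl) dPi dPsi).
exact: gauge_constant (PiP _ rl).
Qed.

Lemma flat_section_of_cl (V : C -> 'cV[C]_mu) : flat_section_cl Q V ->
  flat_section Q r (fun p =>
    if `[< logdisc r p.2 >] then P (- cexp p.1) p.2 *m V p.1 else 0).
Proof.
move=> fV; have dV := (flat_section_clE V).2 fV.
have near_in (L : C) : logdisc r L -> \forall l \near L, `[< logdisc r l >].
  by move=> rL; apply: filterS (logdisc_near rL) => l rl; apply/asboolP.
(* The formula without its cutoff; it agrees with the section near every point over [logdisc r]. *)
pose F (p : C * C) : 'cV[C]_mu := P (- cexp p.1) p.2 *m V p.1.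
have dF : holomorphic2 [set p : C * C | logdisc r p.2] F.
  apply: holomorphic2_mulmx => i j p rp; last first.
    apply: (@differentiable_comp _ _ _ _ fst (fun w => V w i j)).
      exact: differentiable_fst.
    by apply/derivable1_diffP; exact: (mx_is_derive_derivable (dV p.1)).
  apply: (@differentiable_comp _ _ _ _ (fun p : C * C => (- cexp p.1 : C, p.2))
    (fun q => P q.1 q.2 i j)); last exact: P_holo.
  apply: differentiable_pair; last exact: differentiable_snd.
  apply: (@differentiable_comp _ _ _ _ fst (fun w : C => - cexp w : C)).
    exact: differentiable_fst.
  by apply/derivable1_diffP; have [] := is_derive_Ncexp p.1.
split=> [s L|i j [s L] rL|s L rL|s L rL] /=.
- by move=> /asboolPn/negPf ->.
- apply: near_eq_differentiable (dF i j (s, L) rL).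
  have : \forall q \near (s, L), `[< logdisc r q.2 >].
    exact: (cvg_snd (near_in L rL)).
  by apply: filterS => q /= ->.
- have dPV := mx_is_deriveM (P_L (- cexp s) rL) (mx_is_derive_cst (V s) L).
  have dPsi : mx_is_derive (fun l => if `[< logdisc r l >]
      then P (- cexp s) l *m V s else 0) L
      (- (omega_x Q (- cexp s) (cexp L) *m P (- cexp s) L) *m V s
        + P (- cexp s) L *m 0).
    move=> i j; apply: near_eq_is_derive (dPV i j).
    by apply: filterS (near_in L rL) => l /= ->.
  rewrite (mx_is_deriveE dPsi) (asboolT rL) mulmx0 addr0 mulNmx mulmxA.
  exact: addNr.
- have dPsi := mx_is_deriveM (P_s s rL) (dV s).
  rewrite (asboolT rL) (mx_is_deriveE dPsi).
  exact: gauge_flat.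
Qed.

End FlatSectionMaps.

(** * Solutions of the classical connection *)

Section ClassicalLimit.
Variables (R : realType) (mu : nat).
Notation C := (Num.NumField.sort (R[i] : numFieldType)).
Variable Q : logConnection (R[i] : numFieldType) mu.
Hypothesis eigenA0 : Ainf Q *m A0 Q 0 - A0 Q 0 *m Ainf Q = A0 Q 0.

Definition classical_solution (s : C) : 'M[C]_mu :=
  mxexp (s *: Ainf Q) *m mxexp (s *: - A0 Q 0).

Definition classical_solution_inv (s : C) : 'M[C]_mu :=
  mxexp (s *: A0 Q 0) *m mxexp (s *: - Ainf Q).

Lemma classical_solution0 : classical_solution 0 = 1%:M.
Proof. by rewrite /classical_solution !scale0r mxexp0 mulmx1. Qed.

Lemma classical_solution_inv0 : classical_solution_inv 0 = 1%:M.
Proof. by rewrite /classical_solution_inv !scale0r mxexp0 mulmx1. Qed.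

Lemma classical_solutionK (s : C) :
  classical_solution_inv s *m classical_solution s = 1%:M.
Proof.
rewrite /classical_solution_inv /classical_solution.
have h1 := mxexpNK (Ainf Q) s; have h2 := mxexpNK (- A0 Q 0) s.
rewrite opprK in h2; move: h1 h2.
move: (mxexp _) (mxexp _) (mxexp _) (mxexp _) => E F G K h1 h2.
by rewrite mulmxA -(mulmxA F) h1 mulmx1.
Qed.

(** Moving A0(0) to the left of e^{s Ainf} produces the factor e^s, so the derivative - A0(0) of the
    second exponent becomes tau A0(0), as [omega_tau] requires. *)
Lemma classical_solution_derive (s : C) :
  mx_is_derive classical_solution s
    (- (omega_tau Q (- cexp s) 0 *m classical_solution s)).
Proof.
have := mx_is_deriveM (mx_is_derive_mxexp (Ainf Q) s)
  (mx_is_derive_mxexp (- A0 Q 0) s).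
by rewrite (product_derivative _ _ (mxexp_eigen s eigenA0)).
Qed.

(** Variation of constants: the inverse solution times V has derivative 0 and equals V(0) at s =
    0. *)
Lemma flat_section_clP (V : C -> 'cV[C]_mu) : flat_section_cl Q V ->
  forall s, V s = classical_solution s *m V 0.
Proof.
move=> /flat_section_clE dV s.
have dXi (w : C) : forall i j,
    derivable (fun z : C => classical_solution_inv z i j) w 1.
  exact: (mx_is_derive_derivable (mx_is_deriveM (mx_is_derive_mxexp _ w)
    (mx_is_derive_mxexp _ w))).
have dXV (w : C) :
    mx_is_derive (fun z => classical_solution_inv z *m V z) w 0.
  have near_inv : \forall z \near w,
      classical_solution_inv z *m classical_solution z = 1%:M.
    by apply: (@filterE _ _ (nbhs_filter (w : C))) => z; exact: classical_solutionK.
  apply: (variation_of_constants near_inv (classical_solution_derive w)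
    (@dXi w) (dV w)).
  exact: gauge_constant (classical_solutionK w).
have := mx_derive0_const s dXV.
rewrite classical_solution_inv0 mul1mx => <-.
by rewrite mulmxA (mulmx1C (classical_solutionK s)) mul1mx.
Qed.

Lemma classical_solution_flat (c : 'cV[C]_mu) :
  flat_section_cl Q (fun s => classical_solution s *m c).
Proof.
apply/flat_section_clE => s.
apply: (mx_is_derive_eq (mx_is_deriveM (classical_solution_derive s)
  (mx_is_derive_cst c s))).
exact: flat_mulmxr.
Qed.

End ClassicalLimit.

(** * The isomorphisms between the spaces of flat sections *)

Section FlatSectionSpaces.
Variables (R : realType) (mu : nat).
Notation C := (Num.NumField.sort (R[i] : numFieldType)).
Variables (Q : logConnection R[i] mu) (r : \bar R).

Lemma ker_nablaP (Psi : ker_nabla Q r) : flat_section Q r Psi.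
Proof. by apply/asboolP; case: Psi. Qed.

Lemma ker_nabla_clP (V : ker_nabla_cl Q) : flat_section_cl Q V.
Proof. by apply/asboolP; case: V. Qed.

Definition to_ker_nabla Psi (fPsi : flat_section Q r Psi) : ker_nabla Q r :=
  KerNabla (asboolT fPsi : Psi \in flat_sections Q r).

Definition to_ker_nabla_cl V (fV : flat_section_cl Q V) : ker_nabla_cl Q :=
  KerNablaCl (asboolT fV : V \in flat_sections_cl Q).

End FlatSectionSpaces.

Lemma adjoint_holomorphic2 (K : numFieldType) n (e : 'M[K]_n) (D : set K)
    (P : K -> K -> 'M[K]_n) :
  holomorphic2 [set p : K * K | D p.2] (fun p => P p.1 p.2) ->
  holomorphic2 [set p : K * K | D p.2]
    (fun p => invmx e *m (P (- p.1) p.2)^T *m e).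
Proof.
move=> dP; have dcst (A : 'M[K]_n) : holomorphic2 [set p : K * K | D p.2] (fun=> A).
  by move=> i j p _; exact: differentiable_cst.
apply: holomorphic2_mulmx (dcst e); apply: holomorphic2_mulmx (dcst _) _.
move=> i j p Dp; under eq_fun do rewrite mxE.
apply: (@differentiable_comp _ _ _ _ (fun p : K * K => (- p.1, p.2))
  (fun q => P q.1 q.2 j i)); last exact: dP.
apply: differentiable_pair; last exact: differentiable_snd.
exact: differentiableN (differentiable_fst _).
Qed.

(* L = ln x and s = ln (- tau), so that (- tau)^B = mxexp (s *: B). The       *)
(* exponent of the second factor is - A0(0): with the sign conventions for    *)
(* nabla and for conformal solutions, A0(0) = [Ainf, A0(0)] and the product   *)
(* with exponent + A0(0) is not flat for nabla^cl unless A0(0) = 0.           *)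
Theorem proposition8p1p1 (R : realType) (mu : nat) (Q : logQDS R[i] mu)
    (r : \bar R) (H : R[i] -> R[i] -> 'M[R[i]]_mu)
    (P : R[i] -> R[i] -> 'M[R[i]]_mu) :
  (0 < r)%E ->
  holomorphic2 [set p : R[i] * R[i] | disc r p.2] (fun p => H p.1 p.2) ->
  (forall tau : R[i], H tau 0 = 1%:M) ->
  (forall tau L : R[i],
     P tau L = H tau (cexp L) *m mxexp (- ((tau * L) *: M1 Q 0))) ->
  fundamental_solution Q r P ->
  canonical_solution Q (gram Q) r P ->
  exists (f : {linear ker_nabla Q r -> ker_nabla_cl Q})
         (g : {linear ker_nabla_cl Q -> 'cV[R[i]]_mu}),
    [/\ bijective f,
        bijective g,
        (forall (Psi : ker_nabla Q r) (s L : R[i]), logdisc r L ->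
           Psi (s, L) = H (- cexp s) (cexp L)
             *m mxexp (- ((- cexp s * L) *: M1 Q 0)) *m f Psi s) &
        (forall (Psicl : ker_nabla_cl Q) (s : R[i]),
           Psicl s = mxexp (s *: Ainf Q) *m mxexp (s *: - A0 Q 0)
             *m g Psicl)].
Proof.
move=> r0 dH H0 PE fundP [symP [delta [Rk [[commR confP] Rk0]]]].
have [_ dP uP xP] := fundP.
(* If delta = 0 the sum has no term of degree 1 and [Rk 1] is unconstrained, so the coefficient is
   set to 0. *)
pose S1 := if delta is 0%N then 0 else Rk 1%N.
have sumR (tau : R[i]) : \sum_(k < delta.+1) tau ^+ k *: Rk k = Rk 0%N + tau *: S1.
  rewrite big_ord_recl expr0 scale1r; congr (_ + _); rewrite /S1.
  case: delta Rk0 {commR confP S1} => [|d] Rk0; first by rewrite big_ord0 scaler0.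
  rewrite big_ord_recl big1 ?addr0 //= => k _.
  by rewrite Rk0 ?scaler0 // !ltnS /= ltn_ord.
have commS : commmx (Rk 0%N) S1 = - S1.
  rewrite /S1; case: delta commR {Rk0 confP sumR S1} => [|d] commR.
    by rewrite /commmx mulmx0 mul0mx subrr oppr0.
  by rewrite commR // scale1r.
have P_conf tau L : tau != 0 -> logdisc r L ->
    omega_tau Q tau (cexp L) *m P tau L
      + tau *: mxderive (fun t => P t L) tau = P tau L *m (Rk 0%N + tau *: S1).
  move=> tau0 rL; have [_ ePt] := confP tau L tau0 rL.
  by rewrite -sumR -ePt; exact: base_change_eq (uP tau L rL) erefl.
have R0E := residue0 r0 dH H0 PE fundP P_conf.
have S1E := residue1 r0 dH H0 PE fundP (@A0_holomorphic _ _ Q) P_conf.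
have P_tau tau L : tau != 0 -> logdisc r L ->
    omega_tau Q tau (cexp L) *m P tau L
      + tau *: mxderive (fun t => P t L) tau = P tau L *m omega_tau Q tau 0.
  move=> tau0 rL; rewrite P_conf // R0E S1E /omega_tau.
  by rewrite scalerN opprD.
(* The conformality relation [R_0, R_1] = - R_1 with R_0 = - Ainf and R_1 = - A0(0). *)
have eigenA0 : Ainf Q *m A0 Q 0 - A0 Q 0 *m Ainf Q = A0 Q 0.
  by move: commS; rewrite R0E S1E /commmx !mulNmx !mulmxN !opprK.
(* A base point of the half-plane, at which the classical limit of a flat section is read off. *)
have [y rL0] : exists y : R, logdisc r (- y)%:C%C.
  have [y] := filter_ex (near_logdisc r0); by exists y.
pose L0 : R[i] := (- y)%:C%C.
pose Pi (tau L : R[i]) := invmx (gram Q) *m (P (- tau) L)^T *m gram Q.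
have dPi : holomorphic2 [set p : R[i] * R[i] | logdisc r p.2]
    (fun p => Pi p.1 p.2) by exact: adjoint_holomorphic2.
have PiP tau L : logdisc r L -> Pi tau L *m P tau L = 1%:M by exact: symP.
pose f0 Psi := to_ker_nabla_cl
  (flat_section_to_cl dP dPi PiP P_tau (ker_nablaP Psi) rL0).
have f0_lin : linear f0.
  move=> a u v; apply/val_inj/funext => s.
  rewrite -[LHS]/(Pi (- cexp s) L0 *m (a *: u (s, L0) + v (s, L0))).
  by rewrite mulmxDr -scalemxAr.
pose f : {linear ker_nabla Q r -> ker_nabla_cl Q} :=
  HB.pack f0 (GRing.isLinear.Build _ _ _ _ _ f0_lin).
pose f_inv V := to_ker_nabla
  (flat_section_of_cl dP xP P_tau (ker_nabla_clP V)).
(* s = 0 is tau = -1, the point whose fiber is the constant space. *)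
pose g0 (V : ker_nabla_cl Q) := V 0.
have g0_lin : linear g0 by [].
pose g : {linear ker_nabla_cl Q -> 'cV[R[i]]_mu} :=
  HB.pack g0 (GRing.isLinear.Build _ _ _ _ _ g0_lin).
pose g_inv c := to_ker_nabla_cl (classical_solution_flat eigenA0 c).
have transport (Psi : ker_nabla Q r) (s L : R[i]) : logdisc r L ->
    Psi (s, L) = P (- cexp s) L *m f Psi s.
  move=> rL; exact: (flat_section_transport dP dPi PiP xP s (ker_nablaP Psi) rL0 rL).
exists f, g; split.
- exists f_inv => [Psi|V]; apply/val_inj/funext.
    (* Off [logdisc r] both sides are 0 by the convention on sections. *)
    move=> [s L] /=; case: asboolP => [rL|nrL]; first by rewrite [RHS]transport.
    by have [->] := ker_nablaP Psi.
  by move=> s /=; rewrite (asboolT rL0) mulmxA PiP // mul1mx.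
- exists g_inv => [V|c].
    by apply/val_inj/funext => s /=; rewrite [RHS](flat_section_clP eigenA0 (ker_nabla_clP V)).
  by rewrite -[LHS]/(classical_solution Q 0 *m c) classical_solution0 mul1mx.
- by move=> Psi s L rL; rewrite -PE; exact: transport.
- by move=> V s; exact: (flat_section_clP eigenA0 (ker_nabla_clP V)).
Qed.
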